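(* Let $t\geq 5$ be an odd integer and $\mathcal{H}=\mathrm{Forb}(K_{2,t})$. Then $$d^*_{\mathcal{H}}=\frac{1}{t+1}\qquad\text{and}\qquad p^*_{\mathcal{H}}\supseteq\left[\frac{2t-1}{t(t+1)},\frac{2}{t+1}\right].$$
   Context: All graphs are finite and simple. $K_{2,t}$ is the complete bipartite graph with parts of sizes $2$ and $t$. For a graph $H$, $\mathrm{Forb}(H)$ is the hereditary property consisting of all graphs with no induced subgraph isomorphic to $H$. For graphs $G,G'$ on the same labeled vertex set, $\mathrm{dist}(G,G')=|E(G)\,\Delta\, E(G')|$; for a hereditary property $\mathcal{H}$ (a set of graphs closed under isomorphism and vertex deletion), $\mathrm{dist}(G,\mathcal{H})=\min\{\mathrm{dist}(G,G'): G'\in\mathcal{H},\ V(G')=V(G)\}$. The edit distance function is $$\mathrm{ed}_{\mathcal{H}}(p)=\lim_{n\to\infty}\max\left\{\mathrm{dist}(G,\mathcal{H}): |V(G)|=n,\ |E(G)|=\left\lfloor p\tbinom n2\right\rfloor\right\}\Big/\tbinom n2,\qquad p\in[0,1].$$ (The limit is known to exist, and the function is known to be continuous and concave.) $d^*_{\mathcal{H}}$ denotes the maximum value of $\mathrm{ed}_{\mathcal{H}}$ on $[0,1]$, and $p^*_{\mathcal{H}}$ denotes the set of all $p\in[0,1]$ at which this maximum is attained. *)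

(* Defs.v *)
From HB Require Import structures.
From mathcomp Require Import all_boot all_order all_algebra.
From mathcomp Require Import all_classical all_reals all_analysis.

Set Implicit Arguments.
Unset Strict Implicit.
Unset Printing Implicit Defensive.

Import Order.TTheory GRing.Theory Num.Theory.
Import numFieldNormedType.Exports.

Local Open Scope classical_set_scope.
Local Open Scope ring_scope.

(* A simple graph on the labeled vertex set T is its set of edges, each edge
   being a 2-element subset of T. *)
Record sgraph (T : finType) := SGraph {
  edges :> {set {set T}};
  edges_card2 : [forall e in edges, #|e| == 2%N] }.

HB.instance Definition _ (T : finType) := [isSub for @edges T].
HB.instance Definition _ (T : finType) := [Countable of sgraph T by <:].
HB.instance Definition _ (T : finType) := [Finite of sgraph T by <:].

Definition adj (T : finType) (G : sgraph T) (x y : T) : bool :=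
  [set x; y]%SET \in edges G.

Definition isomorphic (T U : finType) (G : sgraph T) (H : sgraph U) : Prop :=
  exists2 f : T -> U, bijective f & forall x y, adj H (f x) (f y) = adj G x y.

Section Induced.
Variables (T : finType) (G : sgraph T) (S : {set T}).

Definition induced_edges : {set {set {x | x \in S}}} :=
  [set e : {set {x | x \in S}} | (val @: e)%SET \in edges G].

Lemma induced_edges_card2 : [forall e in induced_edges, #|e| == 2%N].
Proof.
apply/forall_inP => e; rewrite inE => eG.
have /forall_inP/(_ _ eG) := edges_card2 G.
by rewrite card_imset //; exact: val_inj.
Qed.

Definition induced : sgraph {x | x \in S} := SGraph induced_edges_card2.
End Induced.

Section CompleteBipartite.
Variables s t : nat.

Definition bipartite_edges : {set {set 'I_s + 'I_t}} :=
  [set [set inl i; inr j]%SET | i in 'I_s, j in 'I_t].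

Lemma bipartite_edges_card2 : [forall e in bipartite_edges, #|e| == 2%N].
Proof. by apply/forall_inP => e /imset2P[i j _ _ ->]; rewrite cards2. Qed.

Definition complete_bipartite : sgraph ('I_s + 'I_t)%type :=
  SGraph bipartite_edges_card2.
End CompleteBipartite.

Definition graph_property := forall T : finType, sgraph T -> Prop.

Definition hereditary (P : graph_property) : Prop :=
  (forall (T U : finType) (G : sgraph T) (H : sgraph U),
     isomorphic G H -> P T G -> P U H) /\
  (forall (T : finType) (G : sgraph T) (S : {set T}),
     P T G -> P _ (induced G S)).

Definition Forb (U : finType) (H : sgraph U) : graph_property :=
  fun T G => forall S : {set T}, ~ isomorphic (induced G S) H.

Lemma adj_induced (T : finType) (G : sgraph T) (S : {set T})
    (x y : {x | x \in S}) : adj (induced G S) x y = adj G (val x) (val y).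
Proof. by rewrite /adj inE imsetU1 imset_set1. Qed.

Lemma ForbPn (T U : finType) (G : sgraph T) (H : sgraph U) :
  (exists S, isomorphic (induced G S) H) <->
  exists2 f : U -> T, injective f & forall x y, adj G (f x) (f y) = adj H x y.
Proof.
split=> [[S [f [g fK gK] fadj]]|[f f_inj fadj]].
  exists (val \o g) => [|x y /=]; first exact: inj_comp val_inj (can_inj gK).
  by rewrite -adj_induced -fadj !gK.
pose S := [set f x | x in [set: U]]%SET.
have fS x : f x \in S by apply/imset_f; rewrite inE.
pose g x : {x | x \in S} := Sub (f x) (fS x).
have g_bij : bijective g.
  apply: inj_card_bij => [x y /(congr1 val) /f_inj //|].
  by rewrite card_sig card_imset // cardsT.
have [h gK hK] := g_bij; exists S; exists h; first by exists g.
by move=> x y; rewrite -[in RHS](hK x) -[in RHS](hK y) adj_induced fadj.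
Qed.

Lemma hereditary_Forb (U : finType) (K : sgraph U) : hereditary (Forb K).
Proof.
split=> [T V G H [f f_bij fadj] GP|T G S0 GP] S SH.
  have /ForbPn[k k_inj kadj] : exists S, isomorphic (induced H S) K by exists S.
  have [g fK gK] := f_bij.
  suff /ForbPn[S' S'K] : exists2 f : U -> T, injective f &
      forall x y, adj G (f x) (f y) = adj K x y by exact: (GP S').
  exists (g \o k) => [|x y /=]; first exact: inj_comp (can_inj gK) k_inj.
  by rewrite -fadj !gK.
have /ForbPn[k k_inj kadj] :
  exists S, isomorphic (induced (induced G S0) S) K by exists S.
suff /ForbPn[S' S'K] : exists2 f : U -> T, injective f &
    forall x y, adj G (f x) (f y) = adj K x y by exact: (GP S').
exists (val \o k) => [|x y /=]; first exact: inj_comp val_inj k_inj.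
by rewrite -adj_induced.
Qed.

Definition edit_dist (T : finType) (G G' : sgraph T) : nat :=
  #|(edges G :\: edges G') :|: (edges G' :\: edges G)|.

Lemma edit_dist_le (T : finType) (G G' : sgraph T) :
  (edit_dist G G' <= 'C(#|T|, 2))%N.
Proof.
rewrite /edit_dist -card_draws; apply/subset_leq_card/fintype.subsetP => e.
have /forall_inP G2 := edges_card2 G; have /forall_inP G'2 := edges_card2 G'.
by rewrite !inE => /orP[] /andP[_] => [/G2|/G'2].
Qed.

(* By edit_dist_le, the default value 'C(#|T|, 2) never undercuts a distance,
   so this is the minimum whenever some graph on T satisfies P. *)
Definition dist_to (P : graph_property) (T : finType) (G : sgraph T) : nat :=
  \big[minn/'C(#|T|, 2)]_(G' : sgraph T | `[< P T G' >]) edit_dist G G'.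

Definition max_dist (R : realType) (P : graph_property) (p : R) (n : nat) : nat :=
  \max_(G : sgraph 'I_n |
        (#|edges G|%:Z == Num.floor (p * 'C(n, 2)%:R))%R) dist_to P G.

(* limn returns an arbitrary default value on divergent sequences; for a
   nontrivial hereditary P this sequence converges for every p in [0, 1]. *)
Definition ed (R : realType) (P : graph_property) (p : R) : R :=
  limn (fun n : nat => (max_dist P p n)%:R / 'C(n, 2)%:R : R).

Definition is_ed_max (R : realType) (P : graph_property) (d : R) : Prop :=
  (exists2 p : R, p \in `[0, 1] & ed P p = d) /\
  (forall p : R, p \in `[0, 1] -> ed P p <= d).

Definition ed_argmax (R : realType) (P : graph_property) : set R :=
  [set p | p \in `[0, 1] /\ is_ed_max P (ed P p)].

(* Main.v *)
Require Import Defs.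
From mathcomp Require Import all_boot all_order all_algebra.
From mathcomp Require Import all_classical all_reals all_analysis.
From mathcomp Require Import ring lra.
Import Order.TTheory GRing.Theory Num.Theory.
Import numFieldNormedType.Exports.
Set Implicit Arguments.
Unset Strict Implicit.
Unset Printing Implicit Defensive.
Local Open Scope ring_scope.

(* Upper bound: colour the vertices with (t+1)/2 pairs of mates, turn colour
   classes into cliques and delete the edges between mates.  The result has no
   induced K_{2,t}, since the t common neighbours would carry distinct colours
   avoiding the mates of the colours of both centres; a uniformly random
   colouring edits each pair with probability 1/(t+1).

   Lower bound: let G be quasirandom of density p and G' an edited graph
   without induced K_{2,t}.  Replace G' by its averages U over a weakly regular
   partition; then the cost of the edits is about the mean of |p - U|, and by
   the counting lemma U has almost no K_{2,t}.  Colour a pair white if U is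
   near 0, black if near 1, gray otherwise.  A colour pattern on k random
   points that occurs with positive probability occurs blown up, with no
   K_{2,t}; each class of the blow-up acts as an independent set (white
   vertex) or contains two adjacent vertices (black vertex).  So the problem
   becomes the minimization of the quadratic form with entries p (white),
   1 - p (black), 0 (gray) over weightings of such a coloured graph.  At a
   minimizer of least support the gray degree of a vertex is an affine function
   of its weight, and the bound on gray codegrees forces the value 1/(t+1) at
   both endpoints of the interval of p, hence between them. *)

(** * Quadratic forms on the simplex *)

(** A weakly regular partition controls the cut norm only globally: single pairs of blocks may be
    irregular, and nothing is known inside a block. The coloured graph is therefore read off from k
    sampled points instead of the partition; an array of t points per class, with a constant pattern
    between classes, then reveals what happens inside a class. The diagonal that the pattern leaves
    open accounts for only k of the k^2 terms.

    Passing from the edited graph to its averages loses one cut error of G per pair of blocks. So G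
    must be quasirandom relative to the number of blocks; this is possible because that number is
    bounded in terms of t, p and the error alone, before G is chosen.

    The endpoints are the values of p for which the gray degrees can be handled. With q = 1/p, a
    minimum below 1/(t+1) gives gray degrees y + (q - 2) x v with y > 1 - q/(t+1). At the left end a
    count of walks of length two leads to a quadratic that is a perfect square; at the right end q -
    2 = (t - 3)/2 matches the bound t - 3 on the codegree of a gray edge, and triangles are
    counted. *)

Section StandardQuadratic.
Local Open Scope classical_set_scope.
Local Open Scope ring_scope.
Variables (R : realType) (k : nat).
Implicit Types (M : 'I_k -> 'I_k -> R) (x y : 'I_k -> R).

Definition weighting x := (forall i, 0 <= x i) /\ \sum_i x i = 1.

Definition quad M x := \sum_i \sum_j M i j * x i * x j.

Lemma weighting_le1 x i : weighting x -> x i <= 1.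
Proof.
move=> [x0 <-]; rewrite (bigD1 i) //= lerDl; exact: sumr_ge0.
Qed.

Lemma continuous_row_sum (T : topologicalType) (f : 'I_k -> T -> R) :
  (forall i, continuous (f i)) -> continuous (fun v => \sum_i f i v).
Proof.
move=> cf; apply: continuous_big => // -[a b] /=.
exact: (@add_continuous R^o).
Qed.

Lemma quad_attains_min M : (0 < k)%N ->
  exists2 x, weighting x & forall y, weighting y -> quad M x <= quad M y.
Proof.
move=> k_gt0.
pose A := [set v : 'rV[R]_k | weighting (v ord0)].
have A0 : A !=set0.
  exists (\row_j (j == Ordinal k_gt0)%:R) => /=; split=> [i|].
    by rewrite mxE ler0n.
  rewrite (bigD1 (Ordinal k_gt0)) //= mxE eqxx big1 ?addr0 // => i /negPf ik.
  by rewrite mxE ik.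
have cA : compact A.
  have cB : compact [set v : 'rV[R]_k | forall i, v ord0 i \in `[0, 1]].
    apply: (@rV_compact R^o k (fun=> `[0, 1]%classic)) => _.
    exact: segment_compact.
  have -> : A = [set v : 'rV[R]_k | \sum_i v ord0 i = 1] `&`
                [set v : 'rV[R]_k | forall i, v ord0 i \in `[0, 1]].
    apply/seteqP; split=> v /=.
      by move=> wv; split=> [|i]; rewrite ?(proj2 wv) // in_itv /= (proj1 wv) weighting_le1.
    by move=> [v1 v01]; split=> // i; have := v01 i; rewrite in_itv /= => /andP[].
  rewrite setIC; apply: compact_closedI => //.
  apply: (@closed_comp _ _ (fun v : 'rV[R]_k => \sum_i v ord0 i) [set x | x = 1]).
    by move=> v _; apply: continuous_row_sum => i; exact: coord_continuous.
  exact: closed_eq.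
have [|v vA vmin] := @EVT_min_rV R k (fun v => quad M (v ord0)) A A0 cA.
  apply: continuous_subspaceT; apply: continuous_row_sum => i.
  apply: continuous_row_sum => j v.
  have c l : {for v, continuous (fun v : 'rV[R]_k => v ord0 l)}.
    exact: coord_continuous.
  have cst : {for v, continuous (fun=> M i j : R)} by exact: cst_continuous.
  have cM := continuousM cst (c i).
  exact: (continuousM cM (c j)).
exists (v ord0) => [|y wy]; first by rewrite inE in vA.
have row_y : (\row_j y j) ord0 = y by apply/funext => j; rewrite mxE.
have := vmin (\row_j y j); rewrite row_y; apply.
by rewrite inE /A /= row_y.
Qed.

(** The directions e_i - e_j keep the total weight and suffice to test optimality on the simplex. *)
Definition transfer x i j (d : R) : 'I_k -> R :=
  fun l => x l + d * ((l == i)%:R - (l == j)%:R).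

Lemma sum_delta (F : 'I_k -> R) i : \sum_l F l * (l == i)%:R = F i.
Proof.
rewrite (bigD1 i) //= eqxx mulr1 big1 ?addr0 // => l /negPf ->.
by rewrite mulr0.
Qed.

Lemma quad_transfer M x i j d : (forall i j, M i j = M j i) ->
  quad M (transfer x i j d) = quad M x
    + 2 * d * (\sum_l M i l * x l - \sum_l M j l * x l)
    + d ^+ 2 * (M i i + M j j - 2 * M i j).
Proof.
move=> Msym; pose e (l : 'I_k) : R := (l == i)%:R - (l == j)%:R.
have sume F : \sum_l F l * e l = F i - F j.
  rewrite /e (eq_bigr (fun l => F l * (l == i)%:R - F l * (l == j)%:R)).
    by rewrite sumrB !sum_delta.
  by move=> l _; rewrite mulrBr.
have -> : quad M (transfer x i j d) = \sum_a \sum_b (M a b * x a * x b +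
    d * (M a b * x b) * e a + d * (M a b * x a) * e b +
    d ^+ 2 * M a b * e b * e a).
  apply: eq_bigr => a _; apply: eq_bigr => b _; rewrite /transfer -/(e a) -/(e b).
  by ring.
rewrite (eq_bigr (fun a => \sum_b M a b * x a * x b +
    (d * \sum_b (M a b * x b)) * e a + d * (M a i * x a) - d * (M a j * x a) +
    (d ^+ 2 * M a i - d ^+ 2 * M a j) * e a)); last first.
  move=> a _; rewrite !big_split /= -!mulr_suml !sume mulr_sumr.
  by ring.
have colE a : \sum_l M l a * x l = \sum_l M a l * x l.
  by apply: eq_bigr => l _; rewrite Msym.
rewrite !big_split /= !sume sumrN -!mulr_sumr !colE (Msym j i) /quad.
by ring.
Qed.

Lemma weighting_transfer x i j d : weighting x -> i != j ->
  - x i <= d -> d <= x j -> weighting (transfer x i j d).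
Proof.
move=> [x0 x1] ij di dj; split=> [l|]; rewrite /transfer.
  have xl := x0 l; case: (eqVneq l i) xl => [->|li] xl.
    by rewrite (negPf ij) /=; lra.
  by case: (eqVneq l j) xl => [->|lj] xl /=; lra.
rewrite big_split /= x1 -mulr_sumr sumrB.
by rewrite -(eq_bigr _ (fun l _ => mul1r _)) sum_delta
  -(eq_bigr _ (fun l _ => mul1r _)) sum_delta subrr mulr0 addr0.
Qed.

(* A minimizer of smallest support is a Karush-Kuhn-Tucker point, and the
   form is strictly convex along each edge of the supporting face: otherwise
   one could move along the edge until its boundary. *)
Lemma quad_minimizer M : (0 < k)%N -> (forall i j, M i j = M j i) ->
  exists x, [/\ weighting x, forall y, weighting y -> quad M x <= quad M y,
    forall i, 0 < x i -> \sum_l M i l * x l = quad M x &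
    forall i j, i != j -> 0 < x i -> 0 < x j -> 2 * M i j < M i i + M j j].
Proof.
move=> k_gt0 Msym.
pose minimizer x := weighting x /\ forall y, weighting y -> quad M x <= quad M y.
pose supp x := [set i | 0 < x i]%SET.
have supp_ex : exists n, `[< exists2 x, minimizer x & #|supp x| = n >].
  have [x wx xmin] := quad_attains_min M k_gt0.
  by exists #|supp x|; apply/asboolP; exists x.
case: (ex_minnP supp_ex) => _ /asboolP[x [wx xmin] <-] nmin.
have x0 := proj1 wx.
exists x.
have KKT i j : i != j -> 0 < x i -> 0 < x j ->
    \sum_l M i l * x l = \sum_l M j l * x l.
  move=> ij xi xj; set A := \sum_l M i l * x l; set A' := \sum_l M j l * x l.
  set B := M i i + M j j - 2 * M i j.
  have ge0 d : - x i <= d -> d <= x j -> 0 <= 2 * d * (A - A') + d ^+ 2 * B.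
    move=> di dj; have := xmin _ (weighting_transfer wx ij di dj).
    by rewrite quad_transfer // -/A -/A' -/B; lra.
  apply/eqP; rewrite -subr_eq0; apply: contraT => A_neq0.
  have A_gt0 : 0 < `|A - A'| by rewrite normr_gt0.
  (* Small enough that moves by [s] and by [- s] both stay in the simplex and that the linear term
     dominates the quadratic one; then one of the two moves would decrease the form. *)
  pose s := Num.min (Num.min (x i) (x j)) (`|A - A'| / (`|B| + 1)).
  have B1_gt0 : 0 < `|B| + 1 by rewrite ltr_wpDl.
  have s_gt0 : 0 < s by rewrite !lt_min xi xj divr_gt0.
  have s1 : s <= x i by rewrite !ge_min lexx.
  have s2 : s <= x j by rewrite !ge_min lexx orbT.
  have s3 : s * (`|B| + 1) <= `|A - A'|.
    by rewrite -ler_pdivlMr // ge_min lexx orbT.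
  have sB : s * B <= s * `|B| by rewrite ler_pM2l // ler_norm.
  have h1 := ge0 s; have h2 := ge0 (- s).
  have {}h1 : 0 <= s * (2 * (A - A') + s * B).
    have -> : s * (2 * (A - A') + s * B) = 2 * s * (A - A') + s ^+ 2 * B by ring.
    by apply: h1; lra.
  have {}h2 : 0 <= s * (- (2 * (A - A')) + s * B).
    have -> : s * (- (2 * (A - A')) + s * B) = 2 * - s * (A - A') + (- s) ^+ 2 * B by ring.
    by apply: h2; lra.
  rewrite pmulr_rge0 // in h1; rewrite pmulr_rge0 // in h2.
  by have [a0|a0] := lerP 0 (A - A');
     move: s3 A_gt0; rewrite ?(ger0_norm a0) ?(ltr0_norm a0); lra.
have row_eq i : 0 < x i -> \sum_l M i l * x l = quad M x.
  move=> xi; rewrite -[LHS]mulr1 -(proj2 wx) mulr_sumr; apply/esym.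
  apply: eq_bigr => j _; have [xj|] := ltP 0 (x j); last first.
    move=> xj; have -> : x j = 0 by apply/le_anti; rewrite xj x0.
    by rewrite mulr0 big1 // => l _; rewrite mulr0 mul0r.
  rewrite mulr_suml; have [->|ij] := eqVneq j i.
    by apply: eq_bigr => l _; ring.
  rewrite -mulr_suml -(KKT j i) // mulr_suml.
  by apply: eq_bigr => l _; ring.
split=> // i j ij xi xj; rewrite ltNge; apply/negP => Bge.
have le_xi : - x i <= x j by have := x0 i; have := x0 j; lra.
have wy := weighting_transfer wx ij le_xi (lexx _).
set y := transfer x i j (x j) in wy.
have qy : quad M y <= quad M x.
  rewrite quad_transfer // (KKT i j) // subrr mulr0 addr0 gerDl.
  by apply: mulr_ge0_le0; [exact: sqr_ge0|lra].
have ymin : minimizer y by split=> // z /xmin; exact: le_trans.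
have := nmin #|supp y|; rewrite leqNgt => /(_ _)/negP; apply.
  by apply/asboolP; exists y.
apply/proper_card/properP; split.
  apply/fintype.subsetP => l; rewrite !inE /y /transfer.
  case: (eqVneq l i) => [->|li]; first by [].
  by case: (eqVneq l j) => [->|lj] /=; lra.
by exists j; rewrite !inE // /y /transfer eqxx eq_sym (negPf ij) -leNgt /=; lra.
Qed.

End StandardQuadratic.

(** * Coloured graphs *)

Section WeightedGraph.
Variables (R : realFieldType) (V : finType) (A : rel V) (x : V -> R).
Variables (t : nat) (q y : R).
Hypotheses (A_sym : symmetric A) (A_irr : irreflexive A).
Hypotheses (x_ge0 : forall v, 0 <= x v) (x_sum1 : \sum_v x v = 1).
Hypothesis A_supp : forall u v, A u v -> 0 < x u.
Hypothesis t_ge5 : (5 <= t)%N.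

Let d v := \sum_w (A v w)%:R * x w.
Let codeg u v := \sum_w (A u w)%:R * (A v w)%:R : R.

(** The Karush-Kuhn-Tucker equation of the form, divided by p: in the application [A] is the gray
    graph on the support, q = 1/p and y = 1 - g/p, where g is the minimum of the form. *)
Hypothesis d_eq : forall v, 0 < x v -> d v = y + (q - 2) * x v.
Hypothesis codeg_adj : forall u v, A u v -> codeg u v <= t%:R - 3.

Let T_ge5 : 5 <= t%:R :> R.
Proof. by rewrite ler_nat. Qed.

Let supp_or0 v : x v = 0 \/ 0 < x v.
Proof. by have := x_ge0 v; rewrite le_eqVlt => /orP[/eqP|]; [left|right]. Qed.

Let d_le1 v : d v <= 1 - x v.
Proof.
rewrite lerBrDl -x_sum1 [leRHS](bigD1 v) //= lerD2l /d.
rewrite (bigD1 v) //= A_irr mul0r add0r ler_sum // => w _.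
by case: (A v w); rewrite ?mul1r ?mul0r.
Qed.

(* Double counting of the paths v0 - w - u, where v0 has the largest weight. *)
Lemma no_gray_weighting_left :
  (forall u v, u != v -> ~~ A u v -> 0 < x u -> 0 < x v -> codeg u v <= t%:R - 1) ->
  q = t%:R * (t%:R + 1) / (2 * t%:R - 1) ->
  (t%:R - 1) / (2 * t%:R - 1) < y -> False.
Proof.
move=> codeg_nadj q_eq y_gt.
have [v0 v0max] : exists v0, forall v, x v <= x v0.
  have [v0 _ | noV] := pickP V; last first.
    move: x_sum1; rewrite big1 ?(eq_sym 0) // => [/esym/eqP|i]; rewrite ?oner_eq0 //.
    by have := noV i.
  by exists [arg max_(v > v0) x v]%O => v; case: arg_maxP => // i _; apply.
have x0 : 0 < x v0.
  have [x00|//] := supp_or0 v0; exfalso; move/eqP: x_sum1; rewrite big1 ?(eq_sym 0) ?oner_eq0 //.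
  by move=> v _; apply/le_anti; rewrite x_ge0 andbT -x00.
pose D := d v0; pose dg := \sum_w (A v0 w)%:R : R.
have dgD : D <= dg * x v0.
  rewrite /D /d /dg mulr_suml ler_sum // => w _.
  exact: ler_wpM2l.
(* Walks v0 - w - u weighted by [x u]. Summing over u first gives the left side through [d_eq].
   Summing over w first gives codegrees: [dg] for u = v0, at most t - 3 for a neighbour u of v0, at
   most t - 1 for any other u. *)
have paths : dg * y + (q - 2) * D <=
    x v0 * dg + (t%:R - 3) * D + (t%:R - 1) * (1 - x v0 - D).
  have -> : dg * y + (q - 2) * D = \sum_u x u * codeg v0 u.
    transitivity (\sum_w (A v0 w)%:R * d w).
      rewrite /D /d /dg mulr_suml mulr_sumr -big_split /=; apply: eq_bigr => w _.
      have [vw|_] := boolP (A v0 w); last by rewrite !mul0r mulr0 addr0.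
      by rewrite -/(d w) d_eq ?mul1r //; apply: (@A_supp _ v0); rewrite A_sym.
    rewrite /d /codeg; under eq_bigr do rewrite mulr_sumr.
    rewrite exchange_big /=; apply: eq_bigr => u _; rewrite mulr_sumr.
    by apply: eq_bigr => w _; rewrite (A_sym w u); ring.
  pose b u : R := dg * (u == v0)%:R + (t%:R - 3) * (A v0 u)%:R
     + (t%:R - 1) * (1 - (u == v0)%:R - (A v0 u)%:R).
  have -> : x v0 * dg + (t%:R - 3) * D + (t%:R - 1) * (1 - x v0 - D) =
      \sum_u x u * b u.
    have e1 : \sum_u x u * (u == v0)%:R = x v0.
      rewrite (bigD1 v0) //= eqxx mulr1 big1 ?addr0 // => u /negPf ->.
      by rewrite mulr0.
    have e2 : \sum_u x u * (A v0 u)%:R = D.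
      by rewrite /D /d; apply: eq_bigr => u _; rewrite mulrC.
    rewrite (eq_bigr (fun u => (dg - (t%:R - 1)) * (x u * (u == v0)%:R) +
      -2 * (x u * (A v0 u)%:R) + (t%:R - 1) * x u)); last by move=> u _; rewrite /b; ring.
    by rewrite !big_split /= -!mulr_sumr e1 e2 x_sum1; ring.
  apply: ler_sum => u _; have [->|xu] := supp_or0 u; first by rewrite !mul0r.
  apply: ler_wpM2l => //; rewrite /b.
  case: (eqVneq u v0) => [->|uv].
    rewrite A_irr /= !mulr0 mulr1 subrr subr0 mulr0 !addr0 /codeg /dg ler_sum // => w _.
    by case: (A v0 w); rewrite ?mulr0 ?mulr1.
  have [vu|nvu] := boolP (A v0 u); first by have := codeg_adj vu; rewrite /=; lra.
  by rewrite eq_sym in uv; have := codeg_nadj _ _ uv nvu x0 xu; rewrite /=; lra.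
have Deq : D = y + (q - 2) * x v0 by exact: d_eq.
have Dle : D <= 1 - x v0 by exact: d_le1.
move: q_eq y_gt; set T := t%:R; move=> q_eq y_gt.
have T5 : 5 <= T by exact: T_ge5.
have T1 : 0 < 2 * T - 1 by lra.
have qT : q * (2 * T - 1) = T * (T + 1) by rewrite q_eq divfK // lt0r_neq0.
pose y0 := (T - 1) / (2 * T - 1).
have y0T : y0 * (2 * T - 1) = T - 1 by rewrite /y0 divfK // lt0r_neq0.
rewrite -/y0 in y_gt.
have y0_gt0 : 0 < y0 by rewrite /y0 divr_gt0 //; lra.
have q_gt2 : 2 < q by rewrite -(ltr_pM2r T1) qT; nra.
set X := x v0 in x0 dgD paths Deq Dle.
(* After rearrangement [dg] occurs in [paths] with the factor y - X, so its lower bound D / X from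
   [dgD] can be inserted only if this factor is nonnegative. *)
have [yX|Xy] := lerP X y.
  have D_gt0 : 0 < D by rewrite Deq; nra.
  have key : (y + (q - 2) * X) * (y + (q - 1) * X) <= (T - 1) * X * (1 - X).
    have : D * (y - X) <= dg * X * (y - X) by rewrite ler_wpM2r // subr_ge0.
    have : X * (dg * (y - X)) <= X * ((T - 1) * (1 - X) - q * D).
      by rewrite ler_pM2l //; lra.
    by rewrite -Deq; nra.
  have : (y0 + (q - 2) * X) * (y0 + (q - 1) * X) < (y + (q - 2) * X) * (y + (q - 1) * X).
    by apply: ltr_pM; nra.
  (* For this q, the two sides of [key] with y replaced by y0 differ by a perfect square; since y >
     y0, [key] fails. *)
  have sq : (y0 + (q - 2) * X) * (y0 + (q - 1) * X) - (T - 1) * X * (1 - X) =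
    (y0 - (T + 1 - q) * X) ^+ 2.
    have qT' : q * T = (T * (T + 1) + q) / 2 by lra.
    have y0T' : y0 * T = (T - 1 + y0) / 2 by lra.
    transitivity (y0 ^+ 2 + (2 * q - 3) * y0 * X + (q ^+ 2 - 3 * q + T + 1) * X ^+ 2
      - (T - 1) * X).
      by ring.
    rewrite -y0T.
    have -> : (y0 - (T + 1 - q) * X) ^+ 2 =
      y0 ^+ 2 - 2 * (T + 1 - q) * y0 * X + ((T + 1) ^+ 2 - 2 * (q * T) - 2 * q + q ^+ 2) * X ^+ 2 by ring.
    by rewrite qT'; field.
  have := sqr_ge0 (y0 - (T + 1 - q) * X); rewrite -sq; lra.
(* If X > y, the bound D <= 1 - X already fails: it says y + (q - 1) X <= 1, while the left side
   exceeds q y0. *)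
have : 1 <= q * y0.
  rewrite -(ler_pM2r T1) -(ler_pM2r T1).
  have -> : q * y0 * (2 * T - 1) * (2 * T - 1) = (q * (2 * T - 1)) * (y0 * (2 * T - 1)) by ring.
  by rewrite qT y0T; nra.
have : q * y0 < y + (q - 1) * X by nra.
lra.
Qed.

(* Sums [x u * (d u)^2] against triangles, which [a b c <= (a b^2 + a c^2) / 2]
   reduces to edges. *)
Lemma no_gray_weighting_right : q - 2 = (t%:R - 3) / 2 -> 1 / 2 < y -> False.
Proof.
move=> q_eq y_gt.
pose G := \sum_u x u * d u.
pose S := \sum_u x u * d u ^+ 2.
pose E := \sum_u x u ^+ 2 * d u.
have d_ge u : 0 < x u -> y <= d u.
  by move=> xu; rewrite d_eq // q_eq lerDl mulr_ge0 ?(ltW xu) //; have := T_ge5; lra.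
have G_gt0 : 0 < G.
  apply: (@lt_le_trans _ _ y); first lra.
  rewrite -[y]mul1r -x_sum1 mulr_suml ler_sum // => u _.
  have [->|xu] := supp_or0 u; first by rewrite !mul0r.
  by rewrite ler_pM2l // d_ge.
(* This is [d_eq] multiplied by [2 * x u * d u] and summed, with 2 (q - 2) = t - 3. *)
have SE : E * (t%:R - 3) = 2 * S - 2 * y * G.
  rewrite /E /S /G !mulr_sumr mulr_suml -sumrB; apply: eq_bigr => u _.
  have [->|xu] := supp_or0 u; first by ring.
  have -> : t%:R - 3 = 2 * (q - 2) by lra.
  have : (q - 2) * x u = d u - y by rewrite d_eq //; lra.
  move=> e; transitivity (2 * x u * d u * ((q - 2) * x u)); first ring.
  by rewrite e; ring.
pose Tr := \sum_u \sum_v \sum_w (A u v)%:R * (A u w)%:R * (A v w)%:R * (x u * x v * x w).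
(* For an edge uv, d u + d v is at most 1 plus the weight of the common neighbourhood. Weighting by
   [x u * x v] and summing turns the left side into 2 S. *)
have S_le : 2 * S <= G + Tr.
  have S1 : S = \sum_u \sum_v (A u v)%:R * (x u * x v) * d u.
    apply: eq_bigr => u _; rewrite expr2 mulrA {1}/d !(mulr_sumr, mulr_suml).
    by apply: eq_bigr => v _; ring.
  have S2 : S = \sum_u \sum_v (A u v)%:R * (x u * x v) * d v.
    rewrite exchange_big S1; apply: eq_bigr => u _; apply: eq_bigr => v _.
    by rewrite A_sym; ring.
  have G1 : G = \sum_u \sum_v (A u v)%:R * (x u * x v).
    by apply: eq_bigr => u _; rewrite /d mulr_sumr; apply: eq_bigr => v _; ring.
  rewrite (_ : 2 * S = S + S); last by ring.
  rewrite {1}S1 S2 G1 /Tr -!big_split /=; apply: ler_sum => u _.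
  rewrite -!big_split /=; apply: ler_sum => v _.
  have [uv|_] := boolP (A u v); last first.
    by rewrite !mul0r big1 ?addr0 // => w _; rewrite !mul0r.
  have : d u + d v <= 1 + \sum_w (A u w)%:R * (A v w)%:R * x w.
    rewrite -[X in _ <= X + _]x_sum1 /d -!big_split /=; apply: ler_sum => w _.
    by case: (A u w); case: (A v w); have := x_ge0 w; rewrite /=; lra.
  rewrite !mul1r => /(ler_wpM2l (mulr_ge0 (x_ge0 u) (x_ge0 v))).
  rewrite !mulrDr mulr1 mulr_sumr => /le_trans -> //.
  rewrite lerD2l mulr_sumr le_eqVlt; apply/orP; left; apply/eqP; apply: eq_bigr => w _ /=.
  by ring.
have Tr_le : Tr <= E * (t%:R - 3).
  pose T1 := \sum_u \sum_v \sum_w (A u v)%:R * (A u w)%:R * (A v w)%:R * (x u * x v ^+ 2).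
  have T1_le : T1 <= E * (t%:R - 3).
    rewrite /T1 exchange_big mulr_suml; apply: ler_sum => v _ /=.
    rewrite /d mulr_sumr mulr_suml; apply: ler_sum => u _.
    rewrite (A_sym v u); have [uv|_] := boolP (A u v); last first.
      by rewrite !(mul0r, mulr0) big1 // => w _; rewrite !mul0r.
    have -> : \sum_w true%:R * (A u w)%:R * (A v w)%:R * (x u * x v ^+ 2) =
       codeg u v * (x u * x v ^+ 2).
      by rewrite /codeg mulr_suml; apply: eq_bigr => w _; rewrite mul1r.
    rewrite mul1r [x v ^+ 2 * _]mulrC [leRHS]mulrC ler_wpM2r ?codeg_adj //.
    by rewrite mulr_ge0 // sqr_ge0.
  apply: le_trans T1_le.
  pose T2 := \sum_u \sum_v \sum_w (A u v)%:R * (A u w)%:R * (A v w)%:R * (x u * x w ^+ 2).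
  have T12 : T2 = T1.
    rewrite /T2 /T1; apply: eq_bigr => u _; rewrite exchange_big /=.
    apply: eq_bigr => v _; apply: eq_bigr => w _; rewrite (A_sym v w); ring.
  suff : 2 * Tr <= T1 + T2 by rewrite T12; lra.
  rewrite /Tr /T1 /T2 mulr_sumr -big_split; apply: ler_sum => u _ /=.
  rewrite mulr_sumr -big_split; apply: ler_sum => v _ /=.
  rewrite mulr_sumr -big_split; apply: ler_sum => w _ /=.
  rewrite -mulrDr mulrCA; apply: ler_wpM2l; first by rewrite !mulr_ge0.
  have := mulr_ge0 (x_ge0 u) (sqr_ge0 (x v - x w)).
  rewrite (_ : x u * (x v - x w) ^+ 2 =
    x u * x v ^+ 2 + x u * x w ^+ 2 - 2 * (x u * x v * x w)); [lra|ring].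
(* Combined, 2 S <= G + E (t - 3) = G + 2 S - 2 y G, and S cancels. *)
have : (2 * y - 1) * G <= 0 by lra.
by rewrite pmulr_rle0 //; lra.
Qed.

End WeightedGraph.

(** * Reduction of coloured graphs to weighted gray graphs *)

Section ColoredGraph.
Variables (R : realType) (k t : nat) (wh bl : rel 'I_k) (wv : pred 'I_k).

Definition gray u v := [&& u != v, ~~ wh u v & ~~ bl u v].

(** The matrix of a coloured regularity graph. An entry is the proportion of pairs to edit at
    density p: white removes all edges, black fills in all non-edges, gray changes nothing. *)
Definition crg_mx (p : R) (u v : 'I_k) : R :=
  if u == v then if wv u then p else 1 - p
  else if wh u v then p else if bl u v then 1 - p else 0.

(* No copy of [K_{2,t}] maps into the coloured graph, where a white vertex
   hosts independent sets and any other vertex hosts at least two adjacent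
   vertices. *)
Record K2t_free : Prop := {
  wh_sym : symmetric wh;
  bl_sym : symmetric bl;
  wh_nbl : forall u v, wh u v -> ~~ bl u v;
  white_pair : forall u v, u != v -> wv u -> wv v -> wh u v;
  white_gray : forall u v w, v != w -> wv u -> gray u v -> gray u w -> bl v w;
  gray_codeg : forall u v (C : {set 'I_k}), ~~ wv u -> ~~ wv v -> gray u v ->
    (forall c, c \in C -> gray u c && gray v c) ->
    (forall c c', c \in C -> c' \in C -> c != c' -> ~~ bl c c') ->
    (#|C| + 3 <= t)%N;
  white_codeg : forall u v (C : {set 'I_k}), u != v -> wh u v ->
    (forall c, c \in C -> gray u c && gray v c) ->
    (forall c c', c \in C -> c' \in C -> c != c' -> ~~ bl c c') ->
    (#|C| + 1 <= t)%N }.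

Hypotheses (t_ge5 : (5 <= t)%N) (free : K2t_free).

Let T : R := t%:R.
Let T_ge5 : 5 <= T. Proof. by rewrite ler_nat. Qed.

(** A minimizer of least support with value below 1/(T + 1) has neither black pairs nor white
    vertices in its support. What remains is a gray graph on black vertices with bounded codegrees,
    which [no_gray_weighting_left] or [no_gray_weighting_right] excludes. *)
Lemma crg_endpoint (p : R) (x : 'I_k -> R) :
  p = (2 * T - 1) / (T * (T + 1)) \/ p = 2 / (T + 1) ->
  weighting x -> 1 / (T + 1) <= quad (crg_mx p) x.
Proof.
move=> p_end wx; have T5 := T_ge5.
have k_gt0 : (0 < k)%N.
  case: k x wx => // x [_]; rewrite big_ord0 => /eqP.
  by rewrite eq_sym oner_eq0.
set M := crg_mx p.
have Msym u v : M u v = M v u.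
  rewrite /M /crg_mx eq_sym; case: eqVneq => [->//|_].
  by rewrite (wh_sym free) (bl_sym free).
have [x' [wx' x'min KKT curv]] := quad_minimizer k_gt0 Msym.
apply: le_trans (x'min _ wx) => {x wx x'min}.
move: x' wx' KKT curv => x [x_ge0 x_sum1] KKT curv.
have T1 : 0 < T + 1 by lra.
have TT : 0 < T * (T + 1) by nra.
have c_eq : 1 / (T + 1) * (T + 1) = 1 by rewrite divfK // lt0r_neq0.
have [p_gt0 p_lt p_c] : [/\ 0 < p, 2 * p < 1 & 1 / (T + 1) <= p * (1 - p)].
  case: p_end => ->.
    have e : (2 * T - 1) / (T * (T + 1)) * (T * (T + 1)) = 2 * T - 1.
      by rewrite divfK // lt0r_neq0.
    move: e; set p0 := (2 * T - 1) / (T * (T + 1)) => e; split.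
    - by rewrite -(pmulr_lgt0 _ TT) e; lra.
    - by rewrite -(ltr_pM2r TT) -mulrA e; nra.
    - rewrite -(ler_pM2r TT) -(ler_pM2r TT).
      have -> : 1 / (T + 1) * (T * (T + 1)) * (T * (T + 1)) =
        T ^+ 2 * (T + 1) * (1 / (T + 1) * (T + 1)) by ring.
      have -> : p0 * (1 - p0) * (T * (T + 1)) * (T * (T + 1)) =
        p0 * (T * (T + 1)) * (T * (T + 1) - p0 * (T * (T + 1))) by ring.
      by rewrite e c_eq; nra.
  have e : 2 / (T + 1) * (T + 1) = 2 by rewrite divfK // lt0r_neq0.
  move: e; set p0 := 2 / (T + 1) => e; split.
  - by rewrite -(pmulr_lgt0 _ T1) e; lra.
  - by rewrite -(ltr_pM2r T1) -mulrA e; lra.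
  - rewrite -(ler_pM2r T1) -(ler_pM2r T1) c_eq.
    have -> : p0 * (1 - p0) * (T + 1) * (T + 1) =
      p0 * (T + 1) * (T + 1 - p0 * (T + 1)) by ring.
    by rewrite e; lra.
set g := quad M x in KKT *; rewrite leNgt; apply/negP => g_lt.
have supp_or0 v : x v = 0 \/ 0 < x v.
  by have := x_ge0 v; rewrite le_eqVlt => /orP[/eqP|]; [left|right].
have M_diag_le v : M v v <= 1 - p by rewrite /M /crg_mx eqxx; case: ifP => _; lra.
have M_ge0 u v : 0 <= M u v.
  by rewrite /M /crg_mx; do 3?[case: ifP => _]; lra.
(* A black pair has entry 1 - p, which no diagonal entry exceeds, so the form would not be strictly
   convex along this edge. *)
have nbl u v : u != v -> 0 < x u -> 0 < x v -> ~~ bl u v.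
  move=> uv xu xv; apply/negP => buv; have := curv _ _ uv xu xv.
  have -> : M u v = 1 - p.
    rewrite /M /crg_mx (negPf uv) buv; case: ifP => // /(wh_nbl free).
    by rewrite buv.
  by have := M_diag_le u; have := M_diag_le v; lra.
(* A white vertex u of the support is the only one there, and by [white_gray] and [nbl] it has at
   most one gray neighbour in the support. Without one, its row gives g = p. With one, v, the rows
   of u and v give g = p (1 - x v) and g >= (1 - p) x v, hence g >= p (1 - p) >= 1/(T + 1). *)
have black v : 0 < x v -> ~~ wv v.
  move=> xu; apply/negP => wu; move: v xu wu => u xu wu.
  have others v : v != u -> 0 < x v -> ~~ wv v.
    move=> vu xv; apply/negP => wvv; have := curv _ _ vu xv xu.
    rewrite /M /crg_mx !eqxx (negPf vu) wu wvv (white_pair free) //; lra.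
  have Mu v : v != u -> 0 < x v -> ~~ gray u v -> M u v = p.
    move=> vu xv; rewrite /gray /M /crg_mx eq_sym vu nbl // ?andbT ?negbK 1?eq_sym //.
    by move=> ->; rewrite eq_sym (negPf vu).
  have Muu : M u u = p by rewrite /M /crg_mx eqxx wu.
  have [v /andP[xv guv]|nogray] := pickP (fun v => (0 < x v) && gray u v); last first.
    have := KKT u xu; rewrite (eq_bigr (fun l => p * x l)).
      by rewrite -mulr_sumr x_sum1; nra.
    move=> l _; have [->|xl] := supp_or0 l; first by rewrite !mulr0.
    have [->|lu] := eqVneq l u; first by rewrite Muu.
    by rewrite Mu //; have := nogray l; rewrite xl /= => ->.
  have vu : v != u by case/and3P: guv; rewrite eq_sym.
  have rowu : g = p * (1 - x v).
    rewrite -(KKT u xu) (eq_bigr (fun l => p * (x l - x l * (l == v)%:R))).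
      rewrite -mulr_sumr sumrB x_sum1 (bigD1 v) //= eqxx big1 ?addr0 ?mulr1 //.
      by move=> l /negPf ->; rewrite mulr0.
    move=> l _; have [->|xl] := supp_or0 l; first by rewrite mul0r subrr !mulr0.
    case: (eqVneq l v) => [->|lv].
      rewrite mulr1 subrr mulr0 /M /crg_mx eq_sym (negPf vu).
      by case/and3P: guv => _ /negPf -> /negPf ->; rewrite mul0r.
    rewrite mulr0 subr0; have [->|lu] := eqVneq l u; first by rewrite Muu.
    rewrite Mu //; apply/negP => gul.
    have := white_gray free lv wu gul guv.
    by apply/negP; exact: nbl.
  have rowv : (1 - p) * x v <= g.
    rewrite -(KKT v xv) (bigD1 v) //= {1}/M /crg_mx eqxx (negPf (others _ vu xv)).
    by rewrite lerDl sumr_ge0 // => l _; rewrite mulr_ge0.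
  by move: rowu rowv; set X := x v => rowu rowv; nra.
pose A u v := [&& u != v, 0 < x u, 0 < x v & ~~ wh u v].
have A_sym : symmetric A.
  by move=> u v; rewrite /A eq_sym (wh_sym free); congr andb; rewrite andbCA.
have A_irr : irreflexive A by move=> u; rewrite /A eqxx.
have A_supp u v : A u v -> 0 < x u by case/and4P.
have A_gray u v : A u v -> gray u v.
  by case/and4P => uv xu xv w; rewrite /gray uv w nbl.
pose q := p^-1; pose y := 1 - g * q.
have pq : p * q = 1 by rewrite /q divff // lt0r_neq0.
have q_gt0 : 0 < q by rewrite invr_gt0.
have d_eq v : 0 < x v -> \sum_w (A v w)%:R * x w = y + (q - 2) * x v.
  move=> xv; set d := \sum_w _.
  have : g = p - p * d + (1 - 2 * p) * x v.
    have p_sum : p = \sum_w p * x w by rewrite -mulr_sumr x_sum1 mulr1.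
    rewrite -(KKT v xv) [X in X - _ + _]p_sum /d !mulr_sumr -sumrB.
    have -> : (1 - 2 * p) * x v = \sum_w (1 - 2 * p) * x w * (w == v)%:R.
      rewrite (bigD1 v) //= eqxx mulr1 big1 ?addr0 // => w /negPf ->.
      by rewrite mulr0.
    rewrite -big_split /=; apply: eq_bigr => w _; have [->|xw] := supp_or0 w.
      by rewrite !mulr0 mul0r subrr addr0.
    rewrite /M /crg_mx /A xv xw eq_sym; case: (eqVneq w v) => [->|wv'] /=.
      by rewrite (negPf (black _ xv)); ring.
    rewrite (negPf (nbl _ _ _ xv xw)) 1?eq_sym //.
    by case: (wh v w) => /=; ring.
  move=> /(congr1 ( *%R q)); rewrite /y => e.
  have {e} : q * g = p * q * (1 - d - 2 * x v) + q * x v by rewrite e; ring.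
  by rewrite pq; lra.
have codeg_card u v : \sum_w (A u w)%:R * (A v w)%:R =
    #|[set w | A u w && A v w]|%:R :> R.
  rewrite -sum1_card natr_sum [RHS]big_mkcond /=; apply: eq_bigr => w _.
  by rewrite inE; case: (A u w); case: (A v w); rewrite ?mul0r ?mulr0 ?mulr1.
have codeg_nbr u v c : c \in [set w | A u w && A v w] ->
    [/\ gray u c && gray v c & 0 < x c].
  rewrite inE => /andP[uc vc]; rewrite !A_gray //; split=> //.
  by rewrite A_sym in uc; exact: A_supp uc.
have codeg_nbl u v c c' : c \in [set w | A u w && A v w] ->
    c' \in [set w | A u w && A v w] -> c != c' -> ~~ bl c c'.
  by move=> /codeg_nbr[_ xc] /codeg_nbr[_ xc'] cc'; exact: nbl.
have codeg_adj u v : A u v -> \sum_w (A u w)%:R * (A v w)%:R <= T - 3.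
  move=> uv; rewrite codeg_card lerBrDr -natrD ler_nat.
  have xu := A_supp _ _ uv; have xv : 0 < x v by rewrite A_sym in uv; exact: A_supp uv.
  apply: (gray_codeg free (black _ xu) (black _ xv) (A_gray _ _ uv)).
    by move=> c /codeg_nbr[].
  exact: codeg_nbl.
have codeg_nadj u v : u != v -> ~~ A u v -> 0 < x u -> 0 < x v ->
    \sum_w (A u w)%:R * (A v w)%:R <= T - 1.
  move=> uv nA xu xv.
  have wuv : wh u v by move: nA; rewrite /A uv xu xv /= negbK.
  rewrite codeg_card lerBrDr natr1 ler_nat -addn1.
  apply: (white_codeg free uv wuv); last exact: codeg_nbl.
  by move=> c /codeg_nbr[].
have gq : g * q < 1 / (T + 1) * q by rewrite ltr_pM2r.
case: p_end => p_eq.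
  apply: (@no_gray_weighting_left R _ A x t q y) => //.
    by rewrite /q p_eq invf_div.
  apply: (@le_lt_trans _ _ (1 - 1 / (T + 1) * q)); last by rewrite /y; lra.
  rewrite /q p_eq invf_div -/T le_eqVlt; apply/orP; left; apply/eqP; field.
  by apply/andP; split; apply: lt0r_neq0; lra.
apply: (@no_gray_weighting_right R _ A x t q y) => //.
  by rewrite /q p_eq invf_div -/T; lra.
have : 1 / (T + 1) * q = 1 / 2.
  by rewrite /q p_eq invf_div; field; exact: lt0r_neq0.
by rewrite /y; lra.
Qed.

(* For fixed weights the form is affine in [p]. *)
Lemma crg_bound (p : R) (x : 'I_k -> R) :
  (2 * T - 1) / (T * (T + 1)) <= p <= 2 / (T + 1) ->
  weighting x -> 1 / (T + 1) <= quad (crg_mx p) x.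
Proof.
move=> /andP[p_ge p_le] wx.
have affine r : quad (crg_mx r) x =
    quad (crg_mx 0) x + r * (quad (crg_mx 1) x - quad (crg_mx 0) x).
  rewrite /quad -sumrB mulr_sumr -big_split /=; apply: eq_bigr => u _.
  rewrite -sumrB mulr_sumr -big_split /=; apply: eq_bigr => v _.
  by rewrite /crg_mx; do 4?[case: ifP => _]; ring.
have := crg_endpoint (or_introl erefl) wx.
have := crg_endpoint (or_intror erefl) wx.
rewrite affine [quad _ x in X in _ -> X -> _]affine [in X in _ -> _ -> X]affine.
move: (quad _ x) (quad _ x - _) => a b.
by have [b_ge0|b_lt0] := lerP 0 b; nra.
Qed.

End ColoredGraph.

(** * Averages and blow-ups *)

Section Average.
Variable R : realFieldType.
Implicit Types X Z : finType.

Definition avg X (F : X -> R) : R := (\sum_x F x) / #|X|%:R.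

Lemma eq_avg X (F G : X -> R) : F =1 G -> avg F = avg G.
Proof. by move=> FG; rewrite /avg (eq_bigr _ (fun x _ => FG x)). Qed.

Lemma le_avg X (F G : X -> R) : (forall x, F x <= G x) -> avg F <= avg G.
Proof. by move=> FG; rewrite ler_wpM2r ?invr_ge0 ?ler0n // ler_sum. Qed.

Lemma avg_ge0 X (F : X -> R) : (forall x, 0 <= F x) -> 0 <= avg F.
Proof. by move=> F0; rewrite mulr_ge0 ?invr_ge0 ?ler0n ?sumr_ge0. Qed.

Lemma avgD X (F G : X -> R) : avg (fun x => F x + G x) = avg F + avg G.
Proof. by rewrite /avg big_split mulrDl. Qed.

Lemma avgZ X (c : R) (F : X -> R) : avg (fun x => c * F x) = c * avg F.
Proof. by rewrite /avg -mulr_sumr mulrA. Qed.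

Lemma avgN X (F : X -> R) : avg (fun x => - F x) = - avg F.
Proof. by rewrite /avg sumrN mulNr. Qed.

Lemma avgB X (F G : X -> R) : avg (fun x => F x - G x) = avg F - avg G.
Proof. by rewrite avgD avgN. Qed.

Lemma avg_sum X (J : Type) (r : seq J) (P : pred J) (F : J -> X -> R) :
  avg (fun x => \sum_(j <- r | P j) F j x) = \sum_(j <- r | P j) avg (F j).
Proof. by rewrite /avg exchange_big /= mulr_suml. Qed.

Lemma avg_cst X (c : R) : (0 < #|X|)%N -> avg (fun _ : X => c) = c.
Proof.
move=> X0; rewrite /avg sumr_const -[c *+ _]mulr_natr mulfK //.
by rewrite pnatr_eq0 -lt0n.
Qed.

Lemma avg_le1 X (F : X -> R) : (forall x, F x <= 1) -> avg F <= 1.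
Proof.
move=> F1; have [X0|] := posnP #|X|; first by rewrite /avg X0 invr0 mulr0.
by move=> /(avg_cst 1) <-; exact: le_avg.
Qed.

Lemma ler_norm_avg X (F : X -> R) : `|avg F| <= avg (fun x => `|F x|).
Proof.
by rewrite /avg normrM normfV normr_nat ler_wpM2r ?invr_ge0 ?ler0n ?ler_norm_sum.
Qed.

(* A coordinate projection [get] with its update [put]; resampling the
   coordinate is the involution (x, z) -> (put x z, get x). *)
Section Resampling.
Variables (X Z : finType) (get : X -> Z) (put : X -> Z -> X).
Hypotheses (putK : forall x z, get (put x z) = z).
Hypothesis put_get : forall x z, put (put x z) (get x) = x.

Let resample (xz : X * Z) := (put xz.1 xz.2, get xz.1).
Let resample_inj : injective resample.
Proof.
apply: inv_inj => -[x z].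
by rewrite /resample /= putK put_get.
Qed.

Lemma avg_get (G : Z -> R) : (0 < #|X|)%N -> avg (fun x => G (get x)) = avg G.
Proof.
move=> X0; have Z0 : (0 < #|Z|)%N by have /card_gt0P[x _] := X0; apply/card_gt0P; exists (get x).
have XZ : (\sum_x G (get x)) * #|Z|%:R = (\sum_z G z) * #|X|%:R.
  transitivity (\sum_(xz : X * Z) G (resample xz).2).
    rewrite -(pair_bigA _ (fun x z => G (get x))) mulr_suml /=.
    by apply: eq_bigr => x _; rewrite sumr_const mulr_natr.
  rewrite -(reindex_inj resample_inj (P := predT) (F := fun xz : X * Z => G xz.2)).
  rewrite -(pair_bigA _ (fun x z => G z)) /= exchange_big mulr_suml /=.
  by apply: eq_bigr => z _; rewrite sumr_const mulr_natr.
rewrite /avg; apply/eqP; rewrite eqr_div ?pnatr_eq0 -?lt0n //.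
by rewrite XZ.
Qed.

Lemma avg_put (G : X -> R) : (0 < #|X|)%N ->
  avg G = avg (fun x => avg (fun z => G (put x z))).
Proof.
move=> X0; have Z0 : (0 < #|Z|)%N by have /card_gt0P[x _] := X0; apply/card_gt0P; exists (get x).
transitivity (avg (fun x : X => avg (fun z : Z => G x))).
  by apply: eq_avg => x; rewrite avg_cst.
rewrite /avg -!mulr_suml; congr (_ / _ / _); rewrite !pair_bigA /=.
by rewrite (reindex_inj resample_inj).
Qed.

End Resampling.
End Average.

Section FunctionAverage.
Variables (R : realFieldType) (T : finType).
Hypothesis T_gt0 : (0 < #|T|)%N.

Lemma card_ffun_gt0 (I : finType) : (0 < #|{: {ffun I -> T}}|)%N.
Proof. by rewrite card_ffun expn_gt0 T_gt0. Qed.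

Definition pull (I V : finType) (psi : V -> I) (x : {ffun I -> T}) :
  {ffun V -> T} := [ffun v => x (psi v)].

(** The update that belongs to the projection [pull psi]; for injective [psi] the two satisfy the
    resampling identities. *)
Definition overwrite (I V : finType) (psi : V -> I) (x : {ffun I -> T})
  (f : {ffun V -> T}) : {ffun I -> T} :=
  [ffun i => if [pick v | psi v == i] is Some v then f v else x i].

Lemma overwrite_in (I V : finType) (psi : V -> I) x f v : injective psi ->
  overwrite psi x f (psi v) = f v.
Proof.
move=> psi_inj; rewrite ffunE; case: pickP => [w /eqP/psi_inj ->//|].
by move=> /(_ v); rewrite eqxx.
Qed.

Lemma overwrite_out (I V : finType) (psi : V -> I) x f i :
  (forall v, psi v != i) -> overwrite psi x f i = x i.
Proof. by move=> psi_i; rewrite ffunE; case: pickP => // v; rewrite (negPf (psi_i v)). Qed.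

Lemma pull_overwrite (I V : finType) (psi : V -> I) : injective psi ->
  forall x f, pull psi (overwrite psi x f) = f.
Proof. by move=> psi_inj x f; apply/ffunP => v; rewrite ffunE overwrite_in. Qed.

Lemma overwrite_pull (I V : finType) (psi : V -> I) : injective psi ->
  forall x f, overwrite psi (overwrite psi x f) (pull psi x) = x.
Proof.
move=> psi_inj x f; apply/ffunP => i; rewrite ffunE.
case: pickP => [v /eqP <-|psi_i]; first by rewrite ffunE.
by rewrite overwrite_out // => v; rewrite psi_i.
Qed.

Lemma avg_pull (I V : finType) (psi : V -> I) (G : {ffun V -> T} -> R) :
  injective psi -> avg (fun x => G (pull psi x)) = avg G.
Proof.
move=> psi_inj.
exact: (avg_get (pull_overwrite psi_inj) (overwrite_pull psi_inj) G (card_ffun_gt0 I)).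
Qed.

Lemma avg_overwrite (I V : finType) (psi : V -> I) (G : {ffun I -> T} -> R) :
  injective psi -> avg G = avg (fun x => avg (fun f => G (overwrite psi x f))).
Proof.
move=> psi_inj.
exact: (avg_put (pull_overwrite psi_inj) (overwrite_pull psi_inj) G (card_ffun_gt0 I)).
Qed.

Definition update (I : finType) (x : {ffun I -> T}) (i : I) (z : T) :
  {ffun I -> T} := [ffun j => if j == i then z else x j].

Lemma avg_update (I : finType) (i : I) (G : {ffun I -> T} -> R) :
  avg G = avg (fun x => avg (fun z => G (update x i z))).
Proof.
apply: (@avg_put _ _ _ (fun x : {ffun I -> T} => x i) (fun x z => update x i z)).
- by move=> x z; rewrite ffunE eqxx.
- by move=> x z; apply/ffunP => j; rewrite !ffunE; case: eqP => // ->.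
- exact: card_ffun_gt0.
Qed.

Lemma avg_ffun1 (I : finType) (i : I) (G : T -> R) :
  avg (fun x : {ffun I -> T} => G (x i)) = avg G.
Proof.
apply: (@avg_get _ _ _ (fun x : {ffun I -> T} => x i) (fun x z => update x i z)).
- by move=> x z; rewrite ffunE eqxx.
- by move=> x z; apply/ffunP => j; rewrite !ffunE; case: eqP => // ->.
- exact: card_ffun_gt0.
Qed.

Lemma avg_ffun2 (I : finType) (i j : I) (G : T -> T -> R) : i != j ->
  avg (fun x : {ffun I -> T} => G (x i) (x j)) = avg (fun z => avg (G z)).
Proof.
move=> ij; rewrite (avg_update j).
transitivity (avg (fun x : {ffun I -> T} => avg (G (x i)))).
  by apply: eq_avg => x; apply: eq_avg => z; rewrite !ffunE eqxx (negPf ij).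
exact: avg_ffun1.
Qed.

Lemma avg_prod (I : finType) (G : T -> R) :
  avg (fun z : {ffun I -> T} => \prod_i G (z i)) = avg G ^+ #|I|.
Proof.
rewrite /avg expr_div_n card_ffun natrX; congr (_ / _).
by rewrite -prodr_const -(bigA_distr_bigA (fun _ z => G z)).
Qed.

End FunctionAverage.

(** * Blow-ups of frequent patterns *)

Section BlowUp.
Variables (R : realFieldType) (k m : nat).

Definition select (T : finType) (x : {ffun 'I_k * 'I_m.+1 -> T})
  (a : {ffun 'I_k -> 'I_m.+1}) : {ffun 'I_k -> T} := [ffun i => x (i, a i)].

(** Interpolates between [P] on row 0 of the array (empty [J]) and the full blow-up (all of 'I_k):
    only the coordinates in [J] may leave row 0. *)
Definition partial_blowup (T : finType) (P : pred {ffun 'I_k -> T})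
  (J : pred 'I_k) (x : {ffun 'I_k * 'I_m.+1 -> T}) : bool :=
  [forall a : {ffun 'I_k -> 'I_m.+1},
     [forall i, ~~ J i ==> (a i == ord0)] ==> P (select x a)].

Definition blowup_density (d : R) : R := (d / 2) ^+ m.+1 * (d / 2).

Lemma blowup_density_gt0 d : 0 < d -> 0 < blowup_density d.
Proof. by move=> d0; rewrite mulr_gt0 ?exprn_gt0 // divr_gt0. Qed.

(** Instead of convexity, the pointwise bound u^(m+1) >= (d/2)^(m+1) (u - d/2) is averaged; this is
    the origin of [blowup_density]. *)
Lemma avg_exp_ge (X : finType) (u : X -> R) (d : R) : 0 <= d -> (0 < #|X|)%N ->
  (forall x, 0 <= u x <= 1) -> d <= avg u ->
  blowup_density d <= avg (fun x => u x ^+ m.+1).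
Proof.
move=> d0 X0 u01 ud.
apply: (@le_trans _ _ (avg (fun x => (d / 2) ^+ m.+1 * (u x - d / 2)))).
  rewrite avgZ avgB avg_cst // ler_wpM2l ?exprn_ge0 ?divr_ge0 //; lra.
apply: le_avg => x; have /andP[u0 u1] := u01 x.
have d2 : 0 <= (d / 2) ^+ m.+1 by rewrite exprn_ge0 // divr_ge0.
have [ux|ux] := lerP (d / 2) (u x); last first.
  by apply: (@le_trans _ _ 0); rewrite ?exprn_ge0 //; apply: mulr_ge0_le0 => //; lra.
apply: (@le_trans _ _ ((d / 2) ^+ m.+1)); last by rewrite ler_pXn2r ?nnegrE //; lra.
by rewrite ler_piMr //; lra.
Qed.

Section Step.
Variables (T : finType) (P : pred {ffun 'I_k -> T}).
Hypothesis T_gt0 : (0 < #|T|)%N.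

(** Given the rest of the array, the m + 1 points of column [v] are independent. Allowing all of
    them in place of row 0 turns the conditional probability [avg (h x)] into its power m + 1. *)
Lemma partial_blowup_step (J : pred 'I_k) (v : 'I_k) (d : R) : ~~ J v -> 0 <= d ->
  d <= avg (fun x => (partial_blowup P J x)%:R) ->
  blowup_density d <= avg (fun x => (partial_blowup P (predU1 v J) x)%:R).
Proof.
move=> Jv d0; rewrite (avg_update T_gt0 (v, ord0)) => d_le.
pose psi (c : 'I_m.+1) := (v, c).
have psi_inj : injective psi by move=> c c' [].
pose h x w : R := (partial_blowup P J (update x (v, ord0) w))%:R.
have h01 x w : 0 <= h x w <= 1 by rewrite ler0n lern1 leq_b1.
apply: (@le_trans _ _ (avg (fun x => avg (h x) ^+ m.+1))).
  apply: avg_exp_ge => // [|x]; first exact: card_ffun_gt0.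
  apply/andP; split; first by apply: avg_ge0 => w; case/andP: (h01 x w).
  by apply: avg_le1 => w; case/andP: (h01 x w).
rewrite [leRHS](avg_overwrite T_gt0 _ psi_inj); apply: le_avg => x.
have -> : avg (h x) ^+ m.+1 =
    avg (fun z : {ffun 'I_m.+1 -> T} => \prod_c h x (z c)).
  by rewrite avg_prod card_ord.
apply: le_avg => z.
have [all_z|] := boolP [forall c, partial_blowup P J (update x (v, ord0) (z c))]; last first.
  rewrite negb_forall => /existsP[c /negPf hc].
  by rewrite (bigD1 c) //= /h hc mul0r ler0n.
rewrite big1 => [|c _]; last by rewrite /h (forallP all_z).
rewrite ler1n lt0b; apply/forallP => a; apply/implyP => /forallP a0.
have /forallP/(_ (update a v ord0))/implyP := forallP all_z (a v).
have -> : select (overwrite psi x z) a =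
    select (update x (v, ord0) (z (a v))) (update a v ord0).
  apply/ffunP => i; rewrite !ffunE; have [->|iv] := eqVneq i v.
    rewrite eqxx; case: pickP => [c /eqP[->]//|/(_ (a v))].
    by rewrite /psi eqxx.
  rewrite xpair_eqE (negPf iv) /=; case: pickP => // c /eqP[vi].
  by rewrite vi eqxx in iv.
apply; apply/forallP => i; apply/implyP => Ji; rewrite ffunE.
have [//|iv] := eqVneq i v; have := a0 i.
by rewrite /= (negPf iv) Ji.
Qed.

End Step.

Definition full_blowup (T : finType) (P : pred {ffun 'I_k -> T})
  (x : {ffun 'I_k * 'I_m.+1 -> T}) : bool :=
  [forall a : {ffun 'I_k -> 'I_m.+1}, P (select x a)].

(** One coordinate is blown up at a time, as in the theorem of Erdos on k-partite hypergraphs. It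
    matters that [d'] is chosen before [T] and [P]. *)
Lemma blowup_dense (d : R) : 0 < d ->
  exists2 d', 0 < d' & forall (T : finType) (P : pred {ffun 'I_k -> T}),
    (0 < #|T|)%N -> d <= avg (fun x => (P x)%:R : R) ->
    d' <= avg (fun x => (full_blowup P x)%:R : R).
Proof.
move=> d0.
suff [d' d'0 Hd'] : exists2 d', 0 < d' & forall (T : finType) (P : pred {ffun 'I_k -> T}),
    (0 < #|T|)%N -> d <= avg (fun x => (P x)%:R : R) ->
    d' <= avg (fun x => (partial_blowup P [pred i in enum 'I_k] x)%:R : R).
  exists d' => // T P T0 /(Hd' T P T0) /le_trans; apply; apply: le_avg => x.
  rewrite ler_nat; case: (boolP (partial_blowup _ _ _)) => //= /forallP Px.
  rewrite lt0b; apply/forallP => a.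
  by apply: (implyP (Px a)); apply/forallP => i; rewrite inE mem_enum.
elim: (enum 'I_k) (enum_uniq 'I_k) => [_|v s IHs /= /andP[vs /IHs[d' d'0 Hd']]].
  exists d => // T P T0 /le_trans; apply.
  pose psi (i : 'I_k) := (i, @ord0 m).
  have psi_inj : injective psi by move=> i j [].
  rewrite -(avg_pull T0 _ psi_inj); apply: le_avg => x.
  rewrite ler_nat; case: (boolP (P _)) => //= Px; rewrite lt0b; apply/forallP => a.
  apply/implyP => /forallP a0; congr (is_true (P _)): Px; apply/ffunP => i.
  by rewrite !ffunE (eqP (implyP (a0 i) _)).
exists (blowup_density d'); first exact: blowup_density_gt0.
move=> T P T0 /(Hd' T P T0); move=> Hs.
exact: (partial_blowup_step T0 (J := [pred i in s]) vs (ltW d'0) Hs).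
Qed.

End BlowUp.

(** * Weak regularity and counting *)

Section ConditionalExpectation.
Variables (R : realFieldType) (Z : finType).
Implicit Types (L : finType) (F : Z -> R).

Definition cexp L (l : Z -> L) F (z : Z) : R :=
  (\sum_(z' | l z' == l z) F z') / #|[pred z' | l z' == l z]|%:R.

Lemma cexp_eq L (l : Z -> L) F z z' : l z = l z' -> cexp l F z = cexp l F z'.
Proof. by rewrite /cexp => ->. Qed.

Lemma cexp_itv L (l : Z -> L) F z : (forall z, 0 <= F z <= 1) -> 0 <= cexp l F z <= 1.
Proof.
move=> F01; apply/andP; split.
  by rewrite divr_ge0 ?ler0n ?sumr_ge0 // => z' _; case/andP: (F01 z').
rewrite ler_pdivrMr ?ltr0n; last by apply/card_gt0P; exists z; rewrite inE.
by rewrite mul1r -sum1_card natr_sum ler_sum // => z' _; case/andP: (F01 z').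
Qed.

Lemma sum_cexp L (l : Z -> L) F (f : L -> R) :
  \sum_z cexp l F z * f (l z) = \sum_z F z * f (l z).
Proof.
rewrite (partition_big l predT) // [RHS](partition_big l predT) //=.
apply: eq_bigr => a _; have [z0 /eqP z0a|noz] := pickP (fun z => l z == a); last first.
  by rewrite !big_pred0.
rewrite (eq_bigr (fun=> cexp l F z0 * f a)) => [|z /eqP za]; last first.
  by rewrite za (@cexp_eq _ _ _ z z0) // za.
rewrite [RHS](eq_bigr (fun z => F z * f a)) => [|z /eqP -> //].
rewrite -[RHS]mulr_suml sumr_const -mulr_natr mulrAC; congr (_ * _).
rewrite /cexp z0a divfK //.
by rewrite pnatr_eq0 -lt0n; apply/card_gt0P; exists z0; rewrite inE z0a.
Qed.

Definition energy L (l : Z -> L) F := \sum_z cexp l F z ^+ 2.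

Lemma energy_le L (l : Z -> L) F : (forall z, 0 <= F z <= 1) -> energy l F <= #|Z|%:R.
Proof.
move=> F01; rewrite /energy -sum1_card natr_sum ler_sum // => z _.
by have /andP[c0 c1] := cexp_itv l z F01; rewrite expr_le1.
Qed.

(* Pythagoras: [cexp l' F - cexp l F] is orthogonal to the functions of [l]. *)
Lemma energy_refine L L' (l : Z -> L) (l' : Z -> L') (pi : L' -> L) F f (e : R) :
  (forall z, pi (l' z) = l z) -> 0 <= e -> (forall b, 0 <= f b <= 1) ->
  e * #|Z|%:R <= `|\sum_z (F z - cexp l F z) * f (l' z)| ->
  energy l F + e ^+ 2 * #|Z|%:R <= energy l' F.
Proof.
move=> pil' e0 f01 dev; set D := fun z => cexp l' F z - cexp l F z.
have lE (g : L -> R) z : g (l z) = g (pi (l' z)) by rewrite pil'.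
pose u a := if [pick z | l z == a] is Some z then cexp l F z else 0.
have uE z : cexp l F z = u (l z).
  rewrite /u; case: pickP => [z' /eqP zz'|/(_ z)]; last by rewrite eqxx.
  exact: cexp_eq.
have pyth : \sum_z D z ^+ 2 = energy l' F - energy l F.
  have cross : \sum_z cexp l' F z * cexp l F z = energy l F.
    rewrite /energy (eq_bigr (fun z => cexp l' F z * (u \o pi) (l' z))); last first.
      by move=> z _; rewrite uE /= pil'.
    rewrite sum_cexp [RHS](eq_bigr (fun z => cexp l F z * u (l z))); last first.
      by move=> z _; rewrite expr2 -uE.
    by rewrite sum_cexp; apply: eq_bigr => z _; rewrite /= pil'.
  rewrite /D (eq_bigr (fun z => cexp l' F z ^+ 2 + cexp l F z ^+ 2 -
     2 * (cexp l' F z * cexp l F z))); last by move=> z _; ring.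
  by rewrite sumrB big_split /= -mulr_sumr cross -/(energy l F) -/(energy l' F); ring.
have devD : \sum_z (F z - cexp l F z) * f (l' z) = \sum_z D z * f (l' z).
  have e1 : \sum_z F z * f (l' z) = \sum_z cexp l' F z * f (l' z) by rewrite sum_cexp.
  rewrite (eq_bigr (fun z => F z * f (l' z) - cexp l F z * f (l' z))); last first.
    by move=> z _; rewrite mulrBl.
  rewrite sumrB e1 -sumrB; by apply: eq_bigr => z _; rewrite -mulrBl.
(* Cauchy-Schwarz in the form (D - c f)^2 >= 0 with f^2 <= 1; c will be e or - e according to the
   sign of the deviation. *)
have bound (c : R) : \sum_z D z ^+ 2 >= 2 * c * (\sum_z D z * f (l' z)) - c ^+ 2 * #|Z|%:R.
  rewrite -sum1_card natr_sum !mulr_sumr -sumrB ler_sum // => z _.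
  have /andP[f0 f1] := f01 (l' z).
  have f2 : f (l' z) ^+ 2 <= 1 by rewrite expr_le1.
  have := sqr_ge0 (D z - c * f (l' z)); rewrite mulr1.
  have := ler_piMr (sqr_ge0 c) f2.
  by move: (f _) (D z) => a b; lra.
suff : e ^+ 2 * #|Z|%:R <= \sum_z D z ^+ 2 by rewrite pyth; lra.
move: dev; rewrite devD; set S := \sum_z _ * _ in bound *.
move=> /(ler_wpM2l e0) dev; have [S0|S0] := lerP 0 S.
  by apply: le_trans (bound e); rewrite ger0_norm // in dev; lra.
by apply: le_trans (bound (- e)); rewrite ltr0_norm // in dev; lra.
Qed.

End ConditionalExpectation.

Section Kernels.
Variables (R : realFieldType) (T : finType).
Implicit Types (W K : T -> T -> R) (A B : {set T}).

Definition step (L : finType) (l : T -> L) W x y : R :=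
  cexp (fun z : T * T => (l z.1, l z.2)) (fun z => W z.1 z.2) (x, y).

Lemma step_itv (L : finType) (l : T -> L) W x y : (forall x y, 0 <= W x y <= 1) ->
  0 <= step l W x y <= 1.
Proof. by move=> W01; apply: cexp_itv => -[]. Qed.

Lemma step_sym (L : finType) (l : T -> L) W x y : (forall x y, W x y = W y x) ->
  step l W x y = step l W y x.
Proof.
move=> Wsym; have swapK : involutive (fun z : T * T => (z.2, z.1)) by case.
rewrite /step /cexp /=; congr (_ / _%:R).
  rewrite (reindex_inj (inv_inj swapK)) /=; apply: eq_big => [z|z _] //.
  by rewrite !xpair_eqE andbC.
rewrite -!sum1_card (reindex_inj (inv_inj swapK)) /=; apply: eq_bigl => z.
by rewrite !inE !xpair_eqE andbC.
Qed.

Definition cut K A B : R := \sum_(x in A) \sum_(y in B) K x y.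

Definition cut_le (c : R) K := forall A B, `|cut K A B| <= c * #|T|%:R ^+ 2.

Lemma cutE K A B :
  cut K A B = \sum_(z : T * T) K z.1 z.2 * ((z.1 \in A) && (z.2 \in B))%:R.
Proof.
rewrite -(pair_bigA _ (fun x y => K x y * ((x \in A) && (y \in B))%:R)) /=.
rewrite /cut big_mkcond; apply: eq_bigr => x _.
case: (x \in A); last by rewrite big1 // => y _; rewrite mulr0.
rewrite big_mkcond; apply: eq_bigr => y _.
by case: (y \in B); rewrite ?mulr1 ?mulr0.
Qed.

(* A bilinear form on [0,1]-valued functions is maximal at indicators. *)
Lemma cut_functions c K (a b : T -> R) :
  (forall A B, cut K A B <= c) ->
  (forall x, 0 <= a x <= 1) -> (forall y, 0 <= b y <= 1) ->
  \sum_x \sum_y K x y * (a x * b y) <= c.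
Proof.
move=> Kc a01 b01.
have pos (f w : T -> R) : (forall x, 0 <= w x <= 1) ->
    \sum_x f x * w x <= \sum_(x in [set x | 0 < f x]) f x.
  move=> w01; rewrite [leRHS]big_mkcond; apply: ler_sum => x _; rewrite inE.
  have /andP[w0 w1] := w01 x; case: ltP => fx; first by rewrite ler_piMr // ltW.
  exact: mulr_le0_ge0.
apply: (@le_trans _ _ (\sum_x (\sum_y K x y * b y) * a x)).
  rewrite le_eqVlt; apply/orP; left; apply/eqP/eq_bigr => x _.
  by rewrite mulr_suml; apply: eq_bigr => y _; ring.
apply: le_trans (pos _ _ a01) _; set A := [set x | _].
rewrite exchange_big /=.
apply: (@le_trans _ _ (\sum_y (\sum_(x in A) K x y) * b y)).
  by rewrite le_eqVlt; apply/orP; left; apply/eqP/eq_bigr => y _; rewrite mulr_suml.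
apply: le_trans (pos _ _ b01) _; rewrite exchange_big; exact: Kc.
Qed.

Lemma cut_le_functions c K (a b : T -> R) : cut_le c K ->
  (forall x, 0 <= a x <= 1) -> (forall y, 0 <= b y <= 1) ->
  `|\sum_x \sum_y K x y * (a x * b y)| <= c * #|T|%:R ^+ 2.
Proof.
move=> Kc a01 b01; rewrite ler_norml lerNl; apply/andP; split; last first.
  by apply: cut_functions => // A B; apply: le_trans (ler_norm _) (Kc A B).
rewrite -sumrN (eq_bigr (fun x => \sum_y (- K x y) * (a x * b y))); last first.
  by move=> x _; rewrite -sumrN; apply: eq_bigr => y _; rewrite mulNr.
apply: cut_functions => // A B.
rewrite /cut (eq_bigr (fun x => - \sum_(y in B) K x y)) => [|x _]; last by rewrite sumrN.
by rewrite sumrN; apply: le_trans (ler_norm _) _; rewrite normrN; exact: Kc.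
Qed.

End Kernels.

(** The Frieze-Kannan energy increment. If sets A and B violate regularity, recording membership in
    both multiplies the number of labels by 4 and raises the energy by at least e^2 |T|^2. The
    energy is at most |T|^2, so fewer than s refinements occur. *)
Lemma weak_regularity (R : archiRealFieldType) (e : R) : 0 < e ->
  exists M : nat, forall (T : finType) (W : T -> T -> R),
    (0 < #|T|)%N -> (forall x y, 0 <= W x y <= 1) ->
    exists (L : finType) (l : T -> L),
      (#|L| <= M)%N /\ cut_le e (fun x y => W x y - step l W x y).
Proof.
move=> e0.
have [s sP] : exists s : nat, 1 < e ^+ 2 * s%:R.
  exists (Num.bound (e ^- 2)).
  by rewrite -ltr_pdivrMl ?exprn_gt0 // mulr1 archi_boundP // invr_ge0 sqr_ge0.
exists (4 ^ s)%N => T W T0 W01.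
pose F (z : T * T) := W z.1 z.2.
pose l2 (L : finType) (l : T -> L) (z : T * T) := (l z.1, l z.2).
have N0 : 0 < #|{: T * T}|%:R :> R by rewrite ltr0n card_prod muln_gt0 T0.
pose regular (L : finType) (l : T -> L) := cut_le e (fun x y => W x y - step l W x y).
suff H j : (j <= s)%N ->
    (exists (L : finType) (l : T -> L), (#|L| <= 4 ^ s)%N /\ regular L l) \/
    exists (L : finType) (l : T -> L), (#|L| <= 4 ^ j)%N /\
      e ^+ 2 * j%:R * #|{: T * T}|%:R <= energy (l2 L l) F.
  have [//|[L [l [_ El]]]] := H s (leqnn s).
  have := energy_le (l2 L l) (F := F) (fun z => W01 z.1 z.2).
  by move=> /(le_trans El); rewrite ger_pMl // leNgt sP.
elim: j => [_|j IHj js].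
  right; exists unit, (fun=> tt); rewrite card_unit; split=> //.
  by rewrite mulr0 mul0r sumr_ge0 // => z _; exact: sqr_ge0.
have [|[L [l [cardL El]]]] := IHj (ltnW js); [by left|].
have [/forallP reg|] := boolP [forall A : {set T}, [forall B : {set T},
    `|cut (fun x y => W x y - step l W x y) A B| <= e * #|T|%:R ^+ 2]].
  left; exists L, l; split=> [|A B]; last exact: (forallP (reg A)).
  by apply: leq_trans cardL _; rewrite leq_exp2l // ltnW.
rewrite negb_forall => /existsP[A]; rewrite negb_forall => /existsP[B].
rewrite -ltNge => /ltW dev; right.
exists (L * bool * bool)%type, (fun x => (l x, x \in A, x \in B)); split.
  by rewrite !card_prod card_bool -mulnA expnS mulnC leq_mul.
pose f (b : (L * bool * bool) * (L * bool * bool)) : R := (b.1.1.2 && b.2.2)%:R.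
have := @energy_refine _ _ _ _ (l2 L l) (l2 _ (fun x => (l x, x \in A, x \in B)))
  (fun b => (b.1.1.1, b.2.1.1)) F f e.
move=> /(_ _ (ltW e0) _ _) -/(_ (fun=> erefl)) H.
apply: le_trans (H _ _).
- by rewrite -natr1 mulrDr mulrDl mulr1 lerD2r.
- by move=> b; rewrite ler0n lern1 leq_b1.
- rewrite card_prod natrM -expr2; apply: le_trans dev _; rewrite cutE.
  by rewrite le_eqVlt; apply/orP; left; apply/eqP; congr (`|_|); apply: eq_bigr => -[].
Qed.

(** * Counting lemma for the cut norm *)

Section Counting.
Variables (R : realFieldType) (T : finType) (k : nat).
Hypothesis T_gt0 : (0 < #|T|)%N.
Notation map := {ffun 'I_k -> T}.
Notation pair := ('I_k * 'I_k)%type.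
Let incr (e : pair) := (e.1 < e.2)%N.
Implicit Types (E : seq pair) (f g h : pair -> T -> T -> R).

Definition density f E : R :=
  avg (fun x : map => \prod_(e <- E) f e (x e.1) (x e.2)).

Lemma prod_itv (J : Type) (r : seq J) (P : pred J) (F : J -> R) :
  (forall j, 0 <= F j <= 1) -> 0 <= \prod_(j <- r | P j) F j <= 1.
Proof.
move=> F01; elim/big_rec: _ => [|j x _ /andP[x0 x1]]; first by rewrite ler01 lexx.
have /andP[F0 F1] := F01 j.
by rewrite mulr_ge0 //= (le_trans (ler_wpM2r x0 F1)) // mul1r.
Qed.

Lemma density_factor (c : R) (K : T -> T -> R) h (e : pair) E : cut_le c K ->
  (e.1 < e.2)%N -> all incr E -> e \notin E ->
  (forall e x y, 0 <= h e x y <= 1) ->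
  `|avg (fun x : map => K (x e.1) (x e.2) * \prod_(e' <- E) h e' (x e'.1) (x e'.2))| <= c.
Proof.
move=> Kc; case: e => i j /= ij E_lt E_e h01.
have jNi : j != i by rewrite neq_ltn ij orbT.
rewrite (avg_update T_gt0 j) (avg_update T_gt0 i).
apply: le_trans (ler_norm_avg _) _.
rewrite -(avg_cst c (card_ffun_gt0 T_gt0 'I_k)); apply: le_avg => x.
pose at_j (e : pair) := (e.1 == j) || (e.2 == j).
pose a z := \prod_(e <- E | ~~ at_j e) h e (update x i z e.1) (update x i z e.2).
pose b z := \prod_(e <- E | at_j e) h e (update x j z e.1) (update x j z e.2).
rewrite (@eq_avg _ _ _ (fun y => avg (fun z => K y z * (a y * b z)))); last first.
  move=> y; apply: eq_avg => z; rewrite !ffunE eqxx (negPf jNi) eq_sym (negPf jNi) eqxx.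
  congr (_ * _); rewrite (bigID at_j) /= mulrC; congr (_ * _).
    apply: eq_bigr => e; rewrite /at_j negb_or => /andP[e1 e2].
    by rewrite !ffunE (negPf e1) (negPf e2).
  rewrite big_seq_cond [RHS]big_seq_cond; apply: eq_bigr => e /andP[eE ej].
  have e12 := allP E_lt _ eE.
  have eij : e != (i, j) by apply: contraNneq E_e => <-.
  rewrite !ffunE; move: eij e12 ej; case: e {eE} => u v /=.
  rewrite xpair_eqE /at_j /= => uvij uv.
  have [uj _|_ /= /eqP vj] := eqVneq u j.
    by case: (eqVneq v i) => // vi; move: uv; rewrite /incr /= uj vi ltnNge (ltnW ij).
  by move: uvij; rewrite vj eqxx andbT => /negPf ->.
have n0 : #|T|%:R != 0 :> R by rewrite pnatr_eq0 -lt0n.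
have -> : avg (fun y => avg (fun z => K y z * (a y * b z))) =
    (\sum_y \sum_z K y z * (a y * b z)) / #|T|%:R ^+ 2.
  by rewrite /avg -mulr_suml expr2 invfM mulrA.
rewrite normrM normfV normrX normr_nat ler_pdivrMr ?exprn_gt0 ?ltr0n //.
by apply: cut_le_functions => // z; exact: prod_itv.
Qed.

Lemma density_close (c : R) f g E : (forall e, cut_le c (fun x y => f e x y - g e x y)) ->
  (forall e x y, 0 <= f e x y <= 1) -> (forall e x y, 0 <= g e x y <= 1) ->
  uniq E -> all incr E ->
  `|density f E - density g E| <= c * (size E)%:R.
Proof.
move=> fg f01 g01 E_uniq E_lt.
(* Telescoping: f is replaced by g one factor at a time. [E2] collects the pairs already carrying g,
   and each replacement costs at most c by [density_factor] for the mixture [h]. *)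
suff H E1 E2 : uniq (E1 ++ E2) -> all incr (E1 ++ E2) ->
    `|avg (fun x : map => (\prod_(e <- E1) f e (x e.1) (x e.2) -
        \prod_(e <- E1) g e (x e.1) (x e.2)) * \prod_(e <- E2) g e (x e.1) (x e.2))|
      <= c * (size E1)%:R.
  have := H E [::]; rewrite cats0 => /(_ E_uniq E_lt); rewrite /density -avgB.
  by congr (`|_| <= _); apply: eq_avg => x; rewrite big_nil mulr1.
elim: E1 E2 => [|e E1 IH] E2 /=.
  move=> _ _; rewrite mulr0 normr_le0 (@eq_avg _ _ _ (fun=> 0)).
    by rewrite avg_cst // card_ffun_gt0.
  by move=> x; rewrite !big_nil subrr mul0r.
rewrite mem_cat negb_or => /andP[/andP[eE1 eE2] u12] /andP[e_lt lt12].
pose h e' := if e' \in E1 then f e' else g e'.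
rewrite (@eq_avg _ _ _ (fun x : map =>
  (f e (x e.1) (x e.2) - g e (x e.1) (x e.2)) *
    \prod_(e' <- E1 ++ E2) h e' (x e'.1) (x e'.2) +
  (\prod_(e <- E1) f e (x e.1) (x e.2) - \prod_(e <- E1) g e (x e.1) (x e.2)) *
    \prod_(e' <- e :: E2) g e' (x e'.1) (x e'.2))); last first.
  move=> x; rewrite big_cat !big_cons /=.
  have -> : \prod_(e' <- E1) h e' (x e'.1) (x e'.2) =
      \prod_(e' <- E1) f e' (x e'.1) (x e'.2).
    by apply: eq_big_seq => e' e'E1; rewrite /h e'E1.
  have -> : \prod_(e' <- E2) h e' (x e'.1) (x e'.2) =
      \prod_(e' <- E2) g e' (x e'.1) (x e'.2).
    apply: eq_big_seq => e' e'E2; rewrite /h ifN //.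
    by move: u12; rewrite cat_uniq => /and3P[_ /hasPn/(_ _ e'E2)].
  by ring.
rewrite avgD; apply: le_trans (ler_normD _ _) _.
rewrite -natr1 mulrDr mulr1 addrC lerD //.
  apply: (IH (e :: E2)).
    by rewrite -cat1s uniq_catCA /= u12 mem_cat negb_or eE1 eE2.
  by move: lt12; rewrite !all_cat /= e_lt.
apply: (@density_factor c (fun x y => f e x y - g e x y) h e) => //; first by rewrite mem_cat negb_or eE1.
by move=> e' x y; rewrite /h; case: ifP.
Qed.

End Counting.

(** * Quasirandom graphs *)

Section Graphs.
Variable T : finType.
Implicit Types (G : sgraph T) (r : rel T) (x y : T) (E : {set {set T}}).

Lemma adjC G x y : adj G x y = adj G y x.
Proof. by rewrite /adj finset.setUC. Qed.

Lemma adj_neq G x y : adj G x y -> x != y.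
Proof.
move=> xy; have /forall_inP/(_ _ xy) := edges_card2 G.
by rewrite cards2; case: (x != y).
Qed.

Lemma card2P (e : {set T}) : #|e| = 2%N -> exists2 z : T * T, z.1 != z.2 & e = [set z.1; z.2]%SET.
Proof. by move=> /eqP/cards2P[x [y [xy ->]]]; exists (x, y). Qed.

Lemma set2_eq (a b x y : T) : a != b ->
  ([set x; y]%SET == [set a; b]%SET) = (x == a) && (y == b) || (x == b) && (y == a).
Proof.
move=> ab; apply/eqP/idP => [xyab|/orP[] /andP[/eqP -> /eqP ->]] //; last exact: finset.setUC.
have: x \in [set a; b]%SET by rewrite -xyab finset.set21.
have: y \in [set a; b]%SET by rewrite -xyab finset.set22.
have: a \in [set x; y]%SET by rewrite xyab finset.set21.
have: b \in [set x; y]%SET by rewrite xyab finset.set22.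
rewrite !inE; do 4!case/orP=> /eqP ?; subst; move: ab; rewrite ?eqxx /= ?orbT //.
Qed.

Lemma sum_set2 E : (forall e, e \in E -> #|e| = 2%N) ->
  (\sum_x \sum_y ([set x; y]%SET \in E) = 2 * #|E|)%N.
Proof.
move=> E2; rewrite pair_bigA /= mulnC -sum_nat_const.
rewrite (eq_bigr (fun z : T * T => \sum_(e in E) ([set z.1; z.2]%SET == e))%N); last first.
  move=> z _; case: (boolP (_ \in E)) => zE.
    by rewrite (bigD1 [set z.1; z.2]%SET) //= eqxx big1 // => e /andP[_]; rewrite eq_sym => /negPf ->.
  by rewrite big1 // => e eE; case: eqP => // ze; rewrite ze eE in zE.
rewrite exchange_big /=; apply: eq_bigr => e /E2/card2P[[a b] /= ab ->].
rewrite (eq_bigr (fun z : T * T => ((z == (a, b)) || (z == (b, a))) : nat)); last first.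
  by move=> [x y] _; rewrite /= set2_eq // !xpair_eqE.
transitivity #|[set (a, b); (b, a)]%SET|; last first.
  by rewrite cards2 xpair_eqE (negPf ab).
rewrite -sum1_card [RHS]big_mkcond; apply: eq_bigr => z _; rewrite !inE.
by case: orb.
Qed.

Lemma card_edge G (e : {set T}) : e \in edges G -> #|e| = 2%N.
Proof. by move=> eG; apply/eqP/(forall_inP (edges_card2 G)). Qed.

Lemma sum_adj G : (\sum_x \sum_y adj G x y = 2 * #|edges G|)%N.
Proof. by apply: sum_set2 => e /card_edge. Qed.

Lemma edit_dist_sum G G' :
  (\sum_x \sum_y (adj G x y (+) adj G' x y) = 2 * edit_dist G G')%N.
Proof.
rewrite -sum_set2; last by move=> e; rewrite !inE => /orP[]/andP[_ /card_edge].
apply: eq_bigr => x _; apply: eq_bigr => y _; rewrite !inE /adj.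
by do 2?case: (_ \in _).
Qed.

Definition graph_of_edges (r : rel T) : {set {set T}} :=
  [set [set z.1; z.2]%SET | z in [set z : T * T | (z.1 != z.2) && r z.1 z.2]%SET]%SET.

Lemma graph_of_edges_card2 r : [forall e in graph_of_edges r, #|e| == 2%N].
Proof.
apply/forall_inP => e /imsetP[[x y]]; rewrite inE /= => /andP[xy _] ->.
by rewrite cards2 xy.
Qed.

Definition graph_of r : sgraph T := SGraph (graph_of_edges_card2 r).

Lemma adj_graph_of r x y : symmetric r -> adj (graph_of r) x y = (x != y) && r x y.
Proof.
move=> rC; rewrite /adj /graph_of /graph_of_edges /=; apply/imsetP/idP => [[[a b]]|xy].
  rewrite inE /= => /andP[ab rab] /eqP; rewrite set2_eq //.
  by case/orP=> /andP[/eqP -> /eqP ->]; rewrite ?ab // eq_sym ab rC.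
by exists (x, y); rewrite ?inE.
Qed.

Lemma subset_of_card (A : finType) (B : {set A}) m : (m <= #|B|)%N ->
  exists2 C : {set A}, C \subset B & #|C| = m.
Proof.
move=> mB; exists [set x in take m (enum B)]%SET.
  by apply/fintype.subsetP => x; rewrite inE => /mem_take; rewrite mem_enum.
by rewrite cardsE (card_uniqP _) ?take_uniq ?enum_uniq // size_takel // -cardE.
Qed.

(** Edges are only deleted or only inserted; one of the two truncated differences is 0 and the other
    is the unavoidable change. This meets the exact edge count that [max_dist] prescribes. *)
Lemma adjust_edges G m : (m <= 'C(#|T|, 2))%N ->
  exists G' : sgraph T, #|edges G'| = m /\
    edit_dist G G' = ((#|edges G| - m) + (m - #|edges G|))%N.
Proof.
move=> mT; have [mG|/ltnW Gm] := leqP m #|edges G|.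
  have [C CG Cm] := subset_of_card mG.
  have C2 : [forall e in C, #|e| == 2%N].
    by apply/forall_inP => e /(fintype.subsetP CG)/card_edge ->.
  exists (SGraph C2); split=> //; rewrite /edit_dist /=.
  have -> : (C :\: edges G = finset.set0)%SET by apply/eqP; rewrite finset.setD_eq0.
  by rewrite finset.setU0 finset.cardsDS // Cm; move: mG; rewrite -subn_eq0 => /eqP ->; rewrite addn0.
pose all2 := [set e : {set T} | #|e| == 2%N]%SET.
have Gall : edges G \subset all2.
  by apply/fintype.subsetP => e /card_edge e2; rewrite inE e2.
have [|D DG Dm] := @subset_of_card _ (all2 :\: edges G)%SET (m - #|edges G|).
  by rewrite finset.cardsDS // card_draws leq_sub2r.
have GD : [disjoint edges G & D].
  rewrite disjoint_sym; apply/pred0P => e /=; apply/negP => /andP[/(fintype.subsetP DG)].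
  by rewrite !inE => /andP[/negP eG _].
have C2 : [forall e in (edges G :|: D)%SET, #|e| == 2%N].
  apply/forall_inP => e; rewrite inE => /orP[/card_edge -> //|/(fintype.subsetP DG)].
  by rewrite !inE => /andP[].
exists (SGraph C2); rewrite /edit_dist /=; split.
  by rewrite finset.cardsU disjoint_setI0 // finset.cards0 subn0 Dm subnKC.
have -> : (edges G :\: (edges G :|: D) = finset.set0)%SET.
  by apply/eqP; rewrite finset.setD_eq0 finset.subsetUl.
rewrite finset.set0U finset.setDUl finset.setDv finset.set0U.
have -> : (D :\: edges G = D)%SET by apply/finset.setDidPl; rewrite disjoint_sym.
by rewrite Dm; move: Gm; rewrite -subn_eq0 => /eqP ->.
Qed.

End Graphs.

Lemma balanced_map (X : finType) n : (0 < #|X|)%N ->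
  exists h : 'I_n -> X, forall u, (#|[pred i | h i == u]| <= n %/ #|X| + 1)%N.
Proof.
move=> X0; have modX (i : nat) : (i %% #|X| < #|X|)%N by rewrite ltn_mod.
exists (fun i : 'I_n => enum_val (Ordinal (modX i))) => u.
pose A := [pred i : 'I_n | enum_val (Ordinal (modX i)) == u].
have divX (i : 'I_n) : (i %/ #|X| < n %/ #|X| + 1)%N.
  by rewrite addn1 ltnS leq_div2r // ltnW.
pose f i := Ordinal (divX i).
rewrite -/A -[X in (_ <= X)%N]card_ord -(@card_in_image _ _ f).
  exact: max_card.
move=> i j; rewrite !inE => /eqP iu /eqP; rewrite -iu => /enum_val_inj/(congr1 val) /= ijm.
move=> /(congr1 val) /= ijd; apply/val_inj => /=.
by rewrite (divn_eq i #|X|) (divn_eq j #|X|) ijm ijd.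
Qed.

(** * Explicit quasirandom graphs *)

Section Quasirandom.
Variable R : archiRealFieldType.

(* On pairs over a field, the kernel [g (a c + b + d)] with [g] of mean zero
   has rows that are exactly orthogonal whenever their first coordinates
   differ. *)
Lemma affine_orthogonal (F : finFieldType) (g : F -> R) (a a' b b' : F) :
  \sum_z g z = 0 -> a != a' ->
  \sum_(z : F * F) g (a * z.1 + b + z.2) * g (a' * z.1 + b' + z.2) = 0.
Proof.
move=> g0 aa'; pose f (z : F * F) := (a * z.1 + b + z.2, a' * z.1 + b' + z.2).
have f_inj : injective f.
  move=> [c d] [c' d'] [e1 e2].
  have : (a - a') * (c - c') = 0.
    have -> : (a - a') * (c - c') = (a * c + b + d) - (a * c' + b + d') -
      ((a' * c + b' + d) - (a' * c' + b' + d')) by ring.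
    by rewrite e1 e2 !subrr.
  move/eqP; rewrite mulf_eq0 !subr_eq0 (negPf aa') /= => /eqP cc'.
  by move: e1; rewrite cc' => /addrI ->.
rewrite -(reindex_inj f_inj (P := predT) (F := fun z : F * F => g z.1 * g z.2)).
rewrite -(pair_bigA _ (fun x y => g x * g y)) /=.
transitivity ((\sum_z g z) * (\sum_z g z)); last by rewrite g0 mul0r.
by rewrite mulr_suml; apply: eq_bigr => z _; rewrite mulr_sumr.
Qed.

(** Cauchy-Schwarz over the rows, written as 2 (c n) G <= (c n)^2 + G^2 for each row sum G, which
    avoids square roots. *)
Lemma cut_quadratic (T : finType) (K : T -> T -> R) (c : R) : 0 < c ->
  (forall B : {set T}, \sum_x (\sum_(y in B) K x y) ^+ 2 <= c ^+ 2 * #|T|%:R ^+ 3) ->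
  cut_le c K.
Proof.
move=> c0 Kc A B; set n := #|T|%:R in Kc *.
have n_ge0 : 0 <= n by exact: ler0n.
have [n0|n_gt0] := eqVneq n 0.
  suff -> : cut K A B = 0 by rewrite normr0 n0 expr0n mulr0.
  rewrite /cut big_pred0 // => x; have /card0_eq/(_ x) : #|T| = 0%N by apply/eqP; rewrite -(eqr_nat R) -/n n0.
  by rewrite inE.
have {}n_gt0 : 0 < n by rewrite lt_neqAle eq_sym n_gt0.
pose G x := \sum_(y in B) K x y.
have bound (s : R) : s * s = 1 -> 2 * (c * n) * (s * cut K A B) <= 2 * (c * n) * (c * n ^+ 2).
  move=> s1; have {s1} : 2 * (c * n) * (s * cut K A B) <= \sum_x ((c * n) ^+ 2 + G x ^+ 2).
    rewrite /cut !mulr_sumr big_mkcond ler_sum // => x _; rewrite -/(G x).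
    case: (x \in A); last by rewrite addr_ge0 ?sqr_ge0.
    have -> : G x ^+ 2 = (s * G x) ^+ 2 by rewrite exprMn [s ^+ 2]expr2 s1 mul1r.
    by have := sqr_ge0 (c * n - s * G x); lra.
  move=> /le_trans; apply; rewrite big_split /= sumr_const -mulr_natr -/n.
  have := Kc B; rewrite -/(G _); lra.
have cn : 0 < 2 * (c * n) by rewrite !mulr_gt0.
rewrite ler_norml lerNl; apply/andP; split.
  by have := bound _ (etrans (mulrNN 1 1) (mulr1 1)); rewrite ler_pM2l // mulN1r.
by have := bound _ (mulr1 1); rewrite ler_pM2l // mul1r.
Qed.

(** The affine kernel on F * F is spread over n vertices by a balanced map. By [affine_orthogonal]
    only rows with equal first coordinate contribute to the second moment, about one pair of rows in
    |F|. The 4 is the square of the factor 2 in [fiber], where |F|^2 <= n absorbs the rounding. *)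
Lemma quasirandom_kernel (F : finFieldType) (g : F -> R) (n : nat) (c : R) :
  \sum_z g z = 0 -> (forall z, `|g z| <= 1) -> (#|F| ^ 2 <= n)%N ->
  4 <= c ^+ 2 * #|F|%:R -> 0 < c ->
  exists K : 'I_n -> 'I_n -> F, (forall x y, K x y = K y x) /\
    cut_le c (fun x y => g (K x y)).
Proof.
move=> g0 g1 Fn cF c0.
have F0 : (0 < #|F|)%N by apply/card_gt0P; exists 0.
have FF0 : (0 < #|{: F * F}|)%N by rewrite card_prod muln_gt0 F0.
have [h hP] := balanced_map n FF0.
exists (fun x y => (h x).1 * (h y).1 + (h x).2 + (h y).2); split.
  by move=> x y; rewrite mulrC -!addrA [(h x).2 + _]addrC.
pose K (u v : F * F) := g (u.1 * v.1 + u.2 + v.2).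
have K1 u v : `|K u v| <= 1 by exact: g1.
have q_gt0 : 0 < #|F|%:R :> R by rewrite ltr0n.
have fiber u : #|[pred i | h i == u]|%:R <= 2 * n%:R / #|F|%:R ^+ 2 :> R.
  rewrite ler_pdivlMr ?exprn_gt0 // -natrX -!natrM ler_nat.
  apply: leq_trans (leq_mul (hP u) (leqnn _)) _.
  rewrite card_prod mulnn mulnDl mul1n mul2n -addnn leq_add //.
  exact: leq_trunc_div.
apply: cut_quadratic => // B; rewrite card_ord.
set m := 2 * n%:R / #|F|%:R ^+ 2 in fiber.
have m0 : 0 <= m by rewrite divr_ge0 ?mulr_ge0 ?exprn_ge0 ?ler0n.
pose H u := \sum_(y in B) K (h y) u.
have step1 : \sum_x (\sum_(y in B) K (h x) (h y)) ^+ 2 <= m * \sum_u H u ^+ 2.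
  rewrite (partition_big h predT) //= mulr_sumr ler_sum // => u _.
  rewrite (eq_bigr (fun=> H u ^+ 2)) => [|x /eqP ->]; last first.
    congr (_ ^+ 2); apply: eq_bigr => y _; rewrite /K; congr (g _).
    by rewrite mulrC -!addrA [u.2 + _]addrC.
  by rewrite sumr_const -[_ *+ _]mulr_natl ler_wpM2r ?sqr_ge0 //; exact: fiber.
apply: le_trans step1 _.
have step2 : \sum_u H u ^+ 2 <= \sum_(y in B) \sum_(y' in B)
    ((h y).1 == (h y').1)%:R * #|F|%:R ^+ 2.
  rewrite (eq_bigr (fun u => \sum_(y in B) \sum_(y' in B) K (h y) u * K (h y') u)); last first.
    by move=> u _; rewrite expr2 mulr_suml; apply: eq_bigr => y _; rewrite mulr_sumr.
  rewrite exchange_big ler_sum //= => y _; rewrite exchange_big ler_sum //= => y' _.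
  case: eqVneq => yy'; last by rewrite affine_orthogonal // mul0r.
  rewrite mul1r expr2 -natrM -card_prod -sum1_card natr_sum ler_sum // => u _.
  apply: le_trans (ler_norm _) _; rewrite normrM -[1%:R]mulr1 ler_pM //.
have step3 : \sum_(y in B) \sum_(y' in B) ((h y).1 == (h y').1)%:R * #|F|%:R ^+ 2 <=
    n%:R * (#|F|%:R * m) * #|F|%:R ^+ 2.
  apply: (@le_trans _ _ (\sum_(y in B) (#|F|%:R * m) * #|F|%:R ^+ 2)); last first.
    rewrite sumr_const -[_ *+ #|B|]mulr_natl -!mulrA ler_wpM2r //.
    by rewrite ler_nat -[leqRHS]card_ord max_card.
  apply: ler_sum => y _; rewrite -mulr_suml ler_wpM2r ?exprn_ge0 ?ler0n //.
  apply: (@le_trans _ _ (\sum_(y' : 'I_n) ((h y).1 == (h y').1)%:R)).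
    by rewrite big_mkcond ler_sum // => y' _; case: ifP.
  apply: (@le_trans _ _ (\sum_(b : F) \sum_(y' | h y' == ((h y).1, b)) 1)); last first.
    rewrite -[#|F|%:R]/(#|F|%:R) -[X in _ <= X%:R * _]sum1_card natr_sum mulr_suml ler_sum // => b _.
    by rewrite mul1r sumr_const; exact: fiber.
  rewrite (exchange_big_dep predT) //= ler_sum // => y' _.
  case: eqVneq => [yy'|_]; last by rewrite sumr_ge0.
  by rewrite (bigD1 (h y').2) /= ?lerDl ?sumr_ge0 // yy'; case: (h y').
apply: le_trans (ler_wpM2l m0 (le_trans step2 step3)) _.
have -> : m * (n%:R * (#|F|%:R * m) * #|F|%:R ^+ 2) = 4 / #|F|%:R * n%:R ^+ 3.
  by rewrite /m; field; exact: lt0r_neq0.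
by rewrite ler_wpM2r ?exprn_ge0 ?ler0n // ler_pdivrMr.
Qed.

End Quasirandom.

Section CutLe.
Variables (R : realFieldType) (T : finType).
Implicit Types K : T -> T -> R.

Lemma cut_leD c c' K K' : cut_le c K -> cut_le c' K' ->
  cut_le (c + c') (fun x y => K x y + K' x y).
Proof.
move=> Kc Kc' A B.
have -> : cut (fun x y => K x y + K' x y) A B = cut K A B + cut K' A B.
  by rewrite /cut -big_split; apply: eq_bigr => x _; rewrite -big_split.
by rewrite mulrDl; apply: le_trans (ler_normD _ _) (lerD (Kc A B) (Kc' A B)).
Qed.

Lemma cut_le_sum c K : \sum_x \sum_y `|K x y| <= c * #|T|%:R ^+ 2 -> cut_le c K.
Proof.
move=> Kc A B; apply: le_trans Kc; apply: le_trans (ler_norm_sum _ _ _) _.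
rewrite big_mkcond ler_sum // => x _; case: ifP => _; last by rewrite sumr_ge0.
apply: le_trans (ler_norm_sum _ _ _) _.
by rewrite big_mkcond ler_sum // => y _; case: ifP.
Qed.

Lemma cut_le_ext c K K' : (forall x y, K x y = K' x y) -> cut_le c K -> cut_le c K'.
Proof.
move=> KK' Kc A B; rewrite /cut -(eq_bigr _ (fun x _ => eq_bigr _ (fun y _ => KK' x y))).
exact: Kc.
Qed.

Lemma cut_le_const c (a : R) : `|a| <= c -> cut_le c (fun _ _ : T => a).
Proof.
move=> ac; apply: cut_le_sum; rewrite !sumr_const -mulrnA -[_ *+ _]mulr_natr natrM -expr2.
by rewrite ler_wpM2r ?exprn_ge0 ?ler0n.
Qed.

Lemma cut_leW c c' K : c <= c' -> cut_le c K -> cut_le c' K.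
Proof. by move=> cc' Kc A B; apply: le_trans (Kc A B) _; rewrite ler_wpM2r ?exprn_ge0 ?ler0n. Qed.

Lemma edit_dist_sumR (G G' : sgraph T) :
  \sum_x \sum_y `|(adj G x y)%:R - (adj G' x y)%:R| = (2 * edit_dist G G')%:R :> R.
Proof.
rewrite -edit_dist_sum natr_sum; apply: eq_bigr => x _; rewrite natr_sum.
apply: eq_bigr => y _.
by case: (adj G x y); case: (adj G' x y); rewrite /= ?subrr ?sub0r ?subr0 ?normrN ?normr0 ?normr1.
Qed.

End CutLe.

Lemma bin2_mul2 n : (2 * 'C(n, 2) = n * n.-1)%N.
Proof. by rewrite -mul_bin_diag bin1. Qed.

Lemma bin2R (R : realFieldType) n : 2 * 'C(n, 2)%:R = n%:R ^+ 2 - n%:R :> R.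
Proof.
rewrite -natrM bin2_mul2; case: n => [|n]; first by rewrite expr0n subrr.
by rewrite /= natrM -[n.+1%:R]natr1; ring.
Qed.

(** Over a field of prime order Q, a pair is an edge if its kernel value lies in a set of floor(p Q)
    elements; a final adjustment makes the number of edges exact. *)
Lemma quasirandom_graph (R : archiRealFieldType) (p c : R) : 0 <= p <= 1 -> 0 < c ->
  exists n0 : nat, forall n, (n0 <= n)%N -> exists G : sgraph 'I_n,
    (#|edges G|%:Z == Num.floor (p * 'C(n, 2)%:R)) /\
    cut_le c (fun x y => (adj G x y)%:R - p).
Proof.
move=> /andP[p0 p1] c0.
(* The budget 9 d: one d each for the cut error of the kernel, for rounding p to s / Q and for the
   diagonal, and 6 d for adjusting the number of edges. *)
pose d := Num.min c 1 / 9.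
have d0 : 0 < d by rewrite divr_gt0 // lt_min c0 ltr01.
have dc : 9 * d <= c by rewrite mulrC divfK // ge_min lexx.
have d1 : 9 * d <= 1 by rewrite mulrC divfK // ge_min lexx orbT.
have [Q Qbig Qprime] := prime_above (Num.bound (4 / d ^+ 2)).
have Qd : 4 <= d ^+ 2 * Q%:R.
  rewrite mulrC -ler_pdivrMr ?exprn_gt0 //; apply: ltW.
  apply: lt_trans (_ : _ < (Num.bound (4 / d ^+ 2))%:R) _; last by rewrite ltr_nat.
  by rewrite archi_boundP // divr_ge0 // sqr_ge0.
have Q0 : 0 < Q%:R :> R by rewrite ltr0n prime_gt0.
have Qd' : 1 / Q%:R <= d by rewrite ler_pdivrMr //; nra.
have [n1 n1d] : exists n1 : nat, 1 <= d * n1%:R.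
  exists (Num.bound (1 / d)); rewrite mulrC -ler_pdivrMr //; apply: ltW.
  by rewrite archi_boundP // divr_ge0 // ltW.
exists (maxn n1 (Q ^ 2)) => n; rewrite geq_max => /andP[n1n Qn].
have nd : 1 <= d * n%:R by apply: le_trans n1d _; rewrite ler_pM2l // ler_nat.
set N := n%:R : R in nd *.
have cardF : #|'F_Q| = Q by exact: card_Fp.
pose s := Num.truncn (p * Q%:R).
have /andP[s1 s2] : s%:R <= p * Q%:R < s.+1%:R.
  by apply: truncn_itv; rewrite mulr_ge0 // ltW.
have sQ : (s <= #|[set: 'F_Q]%SET|)%N.
  by rewrite finset.cardsT cardF -(ler_nat R); apply: le_trans s1 _; rewrite ler_piMl // ltW.
have [S _ cardS] := subset_of_card sQ.
pose g (z : 'F_Q) : R := (z \in S)%:R - s%:R / Q%:R.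
have g_sum : \sum_z g z = 0.
  rewrite /g sumrB sumr_const -[_ *+ _]mulr_natr cardF divfK ?lt0r_neq0 //.
  suff -> : \sum_z (z \in S)%:R = s%:R :> R by rewrite subrr.
  rewrite -cardS -sum1_card natr_sum [RHS]big_mkcond /=.
  by apply: eq_bigr => z _; case: (z \in S).
have sQ01 : 0 <= (s%:R / Q%:R : R) <= 1.
  rewrite divr_ge0 //= ler_pdivrMr // mul1r ler_nat.
  by move: sQ; rewrite finset.cardsT cardF.
have g_le z : `|g z| <= 1.
  by rewrite /g; case: (z \in S); rewrite ler_norml /=; lra.
have [|||K [Ksym Kcut]] := quasirandom_kernel (n := n) (c := d) g_sum g_le; rewrite ?cardF //.
pose r : rel 'I_n := fun x y => K x y \in S.
have rC : symmetric r by move=> x y; rewrite /r Ksym.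
pose G0 := graph_of r.
have N2 : N <= d * N ^+ 2 by rewrite expr2 mulrA ler_peMl // ler0n.
have G0cut : cut_le (3 * d) (fun x y => (adj G0 x y)%:R - p).
  have -> : 3 * d = d + d + d by ring.
  have e1 : cut_le d (fun _ _ : 'I_n => s%:R / Q%:R - p).
    apply: cut_le_const; apply: le_trans Qd'.
    have -> : p = p * Q%:R / Q%:R by rewrite mulfK // lt0r_neq0.
    rewrite -mulrBl normrM [`|_^-1|]gtr0_norm ?invr_gt0 // ler_pM2r ?invr_gt0 //.
    by rewrite ler_norml; move: s2; rewrite -natr1; lra.
  have e2 : cut_le d (fun x y : 'I_n => - ((x == y) && r x y)%:R).
    apply: cut_le_sum; rewrite card_ord; apply: le_trans N2.
    rewrite -[N]/(n%:R) -[X in _ <= X%:R]card_ord -sum1_card natr_sum ler_sum // => x _.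
    rewrite (bigD1 x) //= eqxx big1 => [|y /negPf yx].
      by rewrite addr0 normrN; case: (r x x); rewrite ?normr0 ?normr1.
    by rewrite eq_sym yx oppr0 normr0.
  apply: cut_le_ext (cut_leD (cut_leD Kcut e1) e2) => x y.
  rewrite adj_graph_of // /g -/(r x y).
  by case: eqVneq => _; case: (r x y) => /=; ring.
have N2_ge0 : 0 <= N ^+ 2 by exact: sqr_ge0.
pose C := 'C(n, 2)%:R : R.
have C2 : 2 * C = N ^+ 2 - N by exact: bin2R.
pose m := Num.truncn (p * C).
have /andP[m1 m2] : m%:R <= p * C < m.+1%:R.
  by apply: truncn_itv; rewrite mulr_ge0.
have mfloor : (m%:Z == Num.floor (p * C)).
  rewrite eq_sym; apply/eqP; apply: floor_def.
  by rewrite -[m%:Z + 1]/((m + 1)%:Z) -!pmulrn addn1 m1.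
have mC : (m <= 'C(#|'I_n|, 2))%N.
  by rewrite card_ord -(ler_nat R); apply: le_trans m1 _; rewrite ler_piMl.
have [G [Gm Gedit]] := adjust_edges G0 mC.
exists G; rewrite Gm; split=> //.
have eG0 : `|2 * #|edges G0|%:R - p * N ^+ 2| <= 3 * d * N ^+ 2.
  have := G0cut finset.setT finset.setT; rewrite card_ord.
  congr (`|_| <= _); rewrite /cut.
  transitivity (\sum_(x : 'I_n) \sum_(y : 'I_n) ((adj G0 x y)%:R - p)).
    by apply: eq_big => [x|x _]; rewrite ?inE //; apply: eq_bigl => y; rewrite inE.
  rewrite -natrM -sum_adj natr_sum.
  rewrite (eq_bigr (fun x => (\sum_y adj G0 x y)%:R - p * N)); last first.
    by move=> x _; rewrite natr_sum sumrB sumr_const card_ord -[p *+ n]mulr_natr.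
  by rewrite sumrB sumr_const card_ord -[_ *+ n]mulr_natr -mulrA -expr2.
have em : `|2 * #|edges G0|%:R - 2 * m%:R| <= 6 * d * N ^+ 2.
  move: eG0 m2; rewrite -natr1 !ler_norml => /andP[h1 h2] m2.
  have pN : p * N <= N by rewrite ler_piMl // ler0n.
  have pC : 2 * (p * C) = p * N ^+ 2 - p * N by rewrite mulrCA C2; ring.
  have pN0 : 0 <= p * N by rewrite mulr_ge0 // ler0n.
  have N1 : 1 <= N by nra.
  by apply/andP; split; lra.
have Gcut : cut_le (6 * d) (fun x y => (adj G x y)%:R - (adj G0 x y)%:R).
  apply: cut_le_sum; rewrite card_ord -/N; apply: le_trans em.
  rewrite (eq_bigr (fun x => \sum_y `|(adj G0 x y)%:R - (adj G x y)%:R|)); last first.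
    by move=> x _; apply: eq_bigr => y _; rewrite distrC.
  rewrite edit_dist_sumR Gedit -mulrBr normrM normr_nat natrM ler_pM2l // natrD.
  have [le_em|/ltnW le_em] := leqP m #|edges G0|.
    have := le_em; rewrite -subn_eq0 => /eqP ->; rewrite natrB // addr0; exact: ler_norm.
  have := le_em; rewrite -subn_eq0 => /eqP ->; rewrite natrB // add0r distrC; exact: ler_norm.
apply: (cut_leW dc).
have -> : 9 * d = 6 * d + 3 * d by ring.
by apply: cut_le_ext (cut_leD Gcut G0cut) => x y; ring.
Qed.

(** * Upper bound *)

Section AverageBounds.
Variables (R : realFieldType) (X : finType).
Implicit Types F G : X -> R.

Lemma avg_witness F : (0 < #|X|)%N -> exists x, F x <= avg F.
Proof.
move=> X0; have /card_gt0P[x0 _] := X0.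
exists [arg min_(x < x0) F x]%O; case: arg_minP => // x _ xmin.
by rewrite -[leLHS](avg_cst _ X0); apply: le_avg => y; exact: xmin.
Qed.

Lemma avg_lt_witness F G : avg F < avg G -> exists x, F x < G x.
Proof.
move=> FG; have [x FGx|noX] := pickP (fun x => F x < G x); first by exists x.
by move: FG; rewrite ltNge le_avg // => x; rewrite leNgt noX.
Qed.

Lemma avg_pred1 (x0 : X) : avg (fun x => (x == x0)%:R) = 1 / #|X|%:R :> R.
Proof. by rewrite /avg (bigD1 x0) //= eqxx big1 ?addr0 // => x /negPf ->. Qed.

End AverageBounds.

Section DistTo.
Variables (P : graph_property) (T : finType) (G : sgraph T).

Lemma dist_to_le (G' : sgraph T) : P G' -> (dist_to P G <= edit_dist G G')%N.
Proof.
move=> PG'; rewrite /dist_to; have := mem_index_enum G'.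
elim: (index_enum _) => // H s IHs; rewrite in_cons big_cons => /orP[/eqP <-|G's].
  by rewrite (asboolT PG') geq_minl.
by case: ifP => _; rewrite ?geq_min IHs ?orbT.
Qed.

(** The first hypothesis covers the default value of the minimum in [dist_to]. *)
Lemma dist_to_ge (R : realFieldType) (d : R) : d <= 'C(#|T|, 2)%:R ->
  (forall G' : sgraph T, P G' -> d <= (edit_dist G G')%:R) -> d <= (dist_to P G)%:R.
Proof.
move=> dC dP; apply: (big_ind (fun m => d <= m%:R)) => // [m m' dm dm'|G' /asboolP/dP //].
by rewrite /minn; case: ifP.
Qed.

End DistTo.

Section UpperBound.
Variables (t s : nat) (T : finType) (G : sgraph T).
Hypothesis ts : t.+1 = (2 * s)%N.
Notation color := ('I_s * bool)%type.
Implicit Type f : {ffun T -> color}.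

Let mate (c : color) : color := (c.1, ~~ c.2).
Let mateK : involutive mate. Proof. by case=> i b; rewrite /mate /= negbK. Qed.

(* Each colour class becomes a clique, with no edge to the class of the mate. *)
Definition colored_rel f x y :=
  (f x == f y) || adj G x y && (f y != mate (f x)).

Lemma colored_rel_sym f : symmetric (colored_rel f).
Proof.
by move=> x y; rewrite /colored_rel eq_sym adjC [f x == mate _]eq_sym (can2_eq mateK mateK).
Qed.

Definition colored_graph f := graph_of (colored_rel f).

Lemma mate_neq c : mate c != c.
Proof. by case: c => i []; rewrite /mate xpair_eqE eqxx. Qed.

Lemma colored_graph_Forb f : Forb (complete_bipartite 2 t) (colored_graph f).
Proof.
have CE : forall x y, x != y -> adj (colored_graph f) x y =
    (f x == f y) || adj G x y && (f y != mate (f x)).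
  by move=> x y xy; rewrite adj_graph_of ?xy //; exact: colored_rel_sym.
suff H : ~ exists2 h : ('I_2 + 'I_t)%type -> T, injective h &
    forall x y, adj (colored_graph f) (h x) (h y) = adj (complete_bipartite 2 t) x y.
  by move=> S HS; apply: H; apply/ForbPn; exists S.
case=> h h_inj hadj.
have adj_ll i i' : adj (complete_bipartite 2 t) (inl i) (inl i') = false.
  apply/negP => /imset2P[a b _ _ /finset.setP/(_ (inr b))].
  by rewrite !inE eqxx orbT.
have adj_rr j j' : adj (complete_bipartite 2 t) (inr j) (inr j') = false.
  apply/negP => /imset2P[a b _ _ /finset.setP/(_ (inl a))].
  by rewrite !inE eqxx.
have adj_lr i j : adj (complete_bipartite 2 t) (inl i) (inr j).
  by apply/imset2P; exists i j.
pose a i := f (h (inl i)); pose c j := f (h (inr j)).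
have a01 : a 0 != a 1.
  apply/negP => /eqP e; have := adj_ll 0 1; rewrite -hadj CE ?(inj_eq h_inj) //.
  by rewrite -/(a 0) -/(a 1) e eqxx.
have c_inj : injective c.
  move=> j j' cjj'; apply/eqP; apply: contraFT (adj_rr j j') => jj'.
  by rewrite -hadj CE ?(inj_eq h_inj) // -/(c j) -/(c j') cjj' eqxx.
have c_mate i j : c j != mate (a i).
  apply/negP => /eqP e; have := adj_lr i j; rewrite -hadj CE ?(inj_eq h_inj) //.
  by rewrite -/(a i) -/(c j) e eqxx andbF orbF eq_sym (negPf (mate_neq _)).
(* The t distinct colours [c j] would have to fit into the t + 1 - 2 colours other than the two
   mates. *)
have := subset_leq_card (_ : [set c j | j in 'I_t]%SET \subset ~: [set mate (a 0); mate (a 1)]%SET).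
rewrite card_imset // card_ord finset.cardsCs finset.setCK cards2 card_prod card_ord card_bool.
rewrite (inj_eq (inv_inj mateK)) a01 mulnC -ts subSS subn1 => tt.
suff /tt : [set c j | j in 'I_t]%SET \subset ~: [set mate (a 0); mate (a 1)]%SET.
  have t0 : (0 < t)%N.
    by rewrite lt0n; apply: contra_eqN ts => /eqP ->; rewrite eq_sym mul2n; case: (s).
  by rewrite -ltnS prednK // ltnn.
by apply/fintype.subsetP => _ /imsetP[j _ ->]; rewrite !inE negb_or !c_mate.
Qed.

Lemma dist_to_Forb_le :
  (dist_to (Forb (complete_bipartite 2 t)) G * t.+1 <= 'C(#|T|, 2))%N.
Proof.
pose R : realFieldType := rat.
have C0 : (0 < #|{: color}|)%N by rewrite card_prod card_ord card_bool mulnC -ts.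
have cardC : #|{: color}| = t.+1 by rewrite card_prod card_ord card_bool mulnC -ts.
pose F f : R := (2 * edit_dist G (colored_graph f))%:R.
(* A pair is edited when it is an edge whose colours are mates or a non-edge whose colours agree. In
   either case, given the colour of one end, exactly one of the t + 1 colours of the other end
   causes the edit. *)
have avgF : avg F = 2 * 'C(#|T|, 2)%:R / t.+1%:R.
  transitivity (\sum_(x : T) \sum_(y | y != x) 1 / t.+1%:R : R).
    rewrite (@eq_avg _ _ _ (fun f : {ffun T -> color} => \sum_x \sum_(y | y != x)
       (if adj G x y then f y == mate (f x) else f y == f x)%:R)); last first.
      move=> f; rewrite /F -edit_dist_sumR; apply: eq_bigr => x _.
      rewrite [RHS]big_mkcond; apply: eq_bigr => y _.
      rewrite adj_graph_of; last exact: colored_rel_sym.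
      rewrite eq_sym /colored_rel; case: eqVneq => [->|yx] /=.
        by have -> : adj G x x = false by apply/negP => /adj_neq; rewrite eqxx.
      have [xy|_] := boolP (adj G x y); rewrite [f x == _]eq_sym /=; last first.
        by rewrite orbF sub0r normrN normr_nat.
      have [->|_] := eqVneq (f y) (mate (f x)).
        by rewrite (negPf (mate_neq _)) subr0 normr1.
      by rewrite orbT subrr normr0.
    rewrite avg_sum; apply: eq_bigr => x _; rewrite avg_sum; apply: eq_bigr => y yx.
    rewrite eq_sym in yx; rewrite -cardC.
    rewrite (@avg_ffun2 _ _ C0 _ x y (fun z w => (if adj G x y then w == mate z else w == z)%:R)) //.
    rewrite (@eq_avg _ _ _ (fun=> 1 / #|{: color}|%:R)); first by rewrite avg_cst.
    by move=> z; case: (adj G x y); exact: avg_pred1.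
  rewrite bin2R.
  rewrite (eq_bigr (fun=> (#|T|%:R - 1) * (1 / t.+1%:R))) => [|x _].
    by rewrite sumr_const -[_ *+ _]mulr_natl !mulrA mulr1; congr (_ / _); ring.
  rewrite sumr_const -[_ *+ _]mulr_natl; congr (_ * _).
  have T0 : (0 < #|T|)%N by apply/card_gt0P; exists x.
  by rewrite -(natrB _ T0) subn1 -(cardC1 x); congr (_%:R); apply: eq_card => y.
have [f] := avg_witness F (card_ffun_gt0 C0 T); rewrite avgF /F ler_pdivlMr ?ltr0n //.
rewrite -!natrM ler_nat -mulnA leq_pmul2l // => /(leq_trans _); apply.
by rewrite leq_pmul2r // dist_to_le //; exact: colored_graph_Forb.
Qed.

End UpperBound.

(** * Lower bound *)

Section K2tDensity.
Variables (R : realFieldType) (t : nat) (T : finType).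
Notation pair := ('I_(2 + t) * 'I_(2 + t))%type.
Implicit Types (U : T -> T -> R) (e : pair).

(* The vertices 0 and 1 of [K_{2,t}] form the side of size two. *)
Definition K2t_pairs : seq pair := [seq e : pair <- enum {: pair} | (e.1 < e.2)%N].

Definition K2t_edge e := (e.1 < 2 <= e.2)%N.

Definition K2t_weight U e x y := if K2t_edge e then U x y else 1 - U x y.

Definition K2t_density U := density (K2t_weight U) K2t_pairs.

Lemma K2t_pairs_uniq : uniq K2t_pairs.
Proof. by rewrite filter_uniq ?enum_uniq. Qed.

Lemma mem_K2t_pairs e : (e \in K2t_pairs) = (e.1 < e.2)%N.
Proof. by rewrite mem_filter mem_enum andbT. Qed.

Lemma K2t_weight_itv U e x y : (forall x y, 0 <= U x y <= 1) ->
  0 <= K2t_weight U e x y <= 1.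
Proof. by move=> /(_ x y); rewrite /K2t_weight; case: ifP => _; lra. Qed.

Variables (U : T -> T -> R) (eta : R).
Hypothesis U01 : forall x y, 0 <= U x y <= 1.
Hypothesis eta0 : 0 < eta.

Definition whiteb x y := U x y <= eta.
Definition blackb x y := 1 - eta <= U x y.

(** A gray pair can serve as an edge and as a non-edge, so a copy has only to avoid white edges and
    black non-edges. Every factor of its weight is then at least [eta]. *)
Definition template_copy (x : {ffun 'I_(2 + t) -> T}) :=
  all (fun e => if K2t_edge e then ~~ whiteb (x e.1) (x e.2)
                else ~~ blackb (x e.1) (x e.2)) K2t_pairs.

Lemma template_copy_density :
  avg (fun x => (template_copy x)%:R) * eta ^+ size K2t_pairs <= K2t_density U.
Proof.
rewrite mulrC -avgZ; apply: le_avg => x.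
have [xcopy|_] := boolP (template_copy x); last first.
  by rewrite mulr0 prodr_ge0 // => e _; case/andP: (K2t_weight_itv e (x e.1) (x e.2) U01).
rewrite mulr1; move: xcopy; rewrite /template_copy.
elim: K2t_pairs => [|e s IHs] /=; first by rewrite big_nil.
rewrite big_cons exprS => /andP[we /IHs IH].
apply: ler_pM => //; rewrite ?exprn_ge0 ?(ltW eta0) //.
move: we; rewrite /K2t_weight; case: ifP => _.
  by rewrite /whiteb -ltNge => /ltW.
by rewrite /blackb -ltNge; lra.
Qed.

Section Array.
Variables (k m : nat) (X : {ffun 'I_k * 'I_m.+1 -> T}).
Notation idx := ('I_k * 'I_m.+1)%type.
Hypothesis U_sym : forall x y, U x y = U y x.
Hypothesis no_copy : forall psi : {ffun 'I_(2 + t) -> idx}, injective psi ->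
  ~~ template_copy (pull psi X).

Let wh (a b : idx) := whiteb (X a) (X b).
Let bl (a b : idx) := blackb (X a) (X b).

(** The list [[:: a, b & s]] is read as an injection of the 2 + t vertices: positions 0 and 1 are
    the centres, the later ones the leaves. *)
Lemma no_copy_seq (a b : idx) (s : seq idx) : uniq [:: a, b & s] -> (t <= size s)%N ->
  ~~ bl a b -> (forall c, c \in s -> ~~ wh a c && ~~ wh b c) ->
  (forall c c', c \in s -> c' \in s -> c != c' -> ~~ bl c c') -> False.
Proof.
move=> abs_uniq ts ab abc cc'.
pose f := [ffun v : 'I_(2 + t) => nth a [:: a, b & s] v].
have in_abs (v : 'I_(2 + t)) : (v < size [:: a, b & s])%N.
  by apply: leq_trans (ltn_ord v) _; rewrite /= !ltnS.
have f_inj : injective f.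
  by move=> v w; rewrite !ffunE => /eqP; rewrite nth_uniq // => /eqP/val_inj.
have f_s (v : 'I_(2 + t)) : (1 < v)%N -> f v \in s.
  rewrite ffunE; move: (in_abs v); case: (nat_of_ord v) => [|[|i]] //= h _.
  by rewrite mem_nth // -ltnS.
apply/negP: (no_copy f_inj); rewrite negbK.
apply/allP => -[v w]; rewrite mem_K2t_pairs /K2t_edge /= => vw.
rewrite !(ffunE (fun v => X (f v))) -/(wh (f v) (f w)) -/(bl (f v) (f w)).
case: ifP => [/andP[v2 w2]|].
  have /andP[ac bc] := abc _ (f_s _ w2).
  by rewrite [f v]ffunE; move: v2; case: (nat_of_ord v) => [|[|?]].
move=> /negbT; rewrite negb_and -!ltnNge => /orP[v2|w2].
  have w2 : (1 < w)%N by exact: ltn_trans vw.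
  apply: cc'; rewrite ?f_s // (inj_eq f_inj).
  by apply: contraTneq vw => ->; rewrite ltnn.
have [v0 w1] : nat_of_ord v = 0%N /\ nat_of_ord w = 1%N.
  by move: vw w2; case: (nat_of_ord v) => [|?]; case: (nat_of_ord w) => [|[|?]].
by rewrite !ffunE v0 w1.
Qed.

Hypotheses (eta_lt : 2 * eta < 1) (tm : t = m.+1) (t_ge2 : (2 <= t)%N).
Hypothesis wh_blowup : forall i j a b a' b', i != j -> wh (i, a) (j, b) = wh (i, a') (j, b').
Hypothesis bl_blowup : forall i j a b a' b', i != j -> bl (i, a) (j, b) = bl (i, a') (j, b').

Definition array_white (i j : 'I_k) := whiteb (X (i, ord0)) (X (j, ord0)).
Definition array_black (i j : 'I_k) := blackb (X (i, ord0)) (X (j, ord0)).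
(** The blow-up leaves the pairs inside a class arbitrary. If one of them is not white, the class
    can host two adjacent vertices; otherwise it hosts independent sets. *)
Definition array_white_vertex (i : 'I_k) :=
  [forall a, forall b, (a != b) ==> whiteb (X (i, a)) (X (i, b))].

Let wh_nbl a b : wh a b -> ~~ bl a b.
Proof. by rewrite /wh /bl /whiteb /blackb -ltNge => h; move: eta_lt; lra. Qed.

Let gray_wh i j a b : gray array_white array_black i j -> ~~ wh (i, a) (j, b).
Proof. by case/and3P => ij wij _; rewrite (wh_blowup a b ord0 ord0 ij). Qed.

Let gray_bl i j a b : gray array_white array_black i j -> ~~ bl (i, a) (j, b).
Proof. by case/and3P => ij _ bij; rewrite (bl_blowup a b ord0 ord0 ij). Qed.

Let grayC i j : gray array_white array_black i j = gray array_white array_black j i.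
Proof.
by rewrite /gray /array_white /array_black /whiteb /blackb eq_sym !(U_sym (X (i, _))).
Qed.

Let blC a b : bl a b = bl b a. Proof. by rewrite /bl /blackb U_sym. Qed.

Let white_nbl i a b : array_white_vertex i -> a != b -> ~~ bl (i, a) (i, b).
Proof. by move=> /forallP/(_ a)/forallP/(_ b)/implyP wi /wi /wh_nbl. Qed.

Let not_white_nwh i : ~~ array_white_vertex i -> exists a b, a != b /\ ~~ wh (i, a) (i, b).
Proof.
rewrite negb_forall => /existsP[a]; rewrite negb_forall => /existsP[b].
by rewrite negb_imply => /andP[ab wab]; exists a, b.
Qed.

(** It has t points, enough for a white class to host all leaves of a copy. *)
Let fiber (i : 'I_k) : seq idx := [seq (i, l) | l <- enum 'I_m.+1].

Let mem_fiber i c : (c \in fiber i) -> c.1 = i.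
Proof. by move=> /mapP[l _ ->]. Qed.

Let fiber_uniq i : uniq (fiber i).
Proof. by rewrite map_inj_uniq ?enum_uniq // => a b []. Qed.

Let fiber_size i : size (fiber i) = t.
Proof. by rewrite size_map size_enum_ord. Qed.

(** Each violated condition yields a copy. [white_pair]: centres in one white class, leaves in the
    other. [white_gray]: leaves in the white class u, centres in v and w. [gray_codeg]: the classes
    u and v each contain two points whose pair is not white; one of the two is a centre, the other a
    leaf, and C supplies the remaining t - 2 leaves. [white_codeg]: centres in u and v, leaves in
    C. *)
Lemma array_K2t_free : K2t_free t array_white array_black array_white_vertex.
Proof.
have m1 : (1 < m.+1)%N by rewrite -tm.
pose o1 := Ordinal m1; have o01 : ord0 != o1 by [].
split.
- by move=> i j; rewrite /array_white /whiteb U_sym.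
- by move=> i j; rewrite /array_black /blackb U_sym.
- by move=> i j; exact: (@wh_nbl (i, ord0) (j, ord0)).
- move=> u v uv wu wv; apply: contraT => nwuv; exfalso.
  apply: (@no_copy_seq (u, ord0) (u, o1) (fiber v)).
  + rewrite /= inE xpair_eqE (negPf o01) andbF fiber_uniq andbT.
    by apply/andP; split; apply/negP => /mem_fiber /= e; rewrite e eqxx in uv.
  + by rewrite fiber_size.
  + exact: white_nbl.
  + by move=> c /mapP[l _ ->]; rewrite !(wh_blowup _ _ ord0 ord0 uv) nwuv.
  + move=> c c' /mapP[l _ ->] /mapP[l' _ ->]; rewrite xpair_eqE eqxx /=.
    exact: white_nbl.
- move=> u v w vw wu uv uw; apply: contraT => nbvw; exfalso.
  apply: (@no_copy_seq (v, ord0) (w, ord0) (fiber u)).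
  + rewrite /= inE xpair_eqE (negPf vw) /= fiber_uniq andbT.
    case/and3P: uv => uv _ _; case/and3P: uw => uw _ _.
    by apply/andP; split; apply/negP => /mem_fiber /= e; rewrite e eqxx in uv uw.
  + by rewrite fiber_size.
  + by [].
  + by move=> c /mapP[l _ ->]; rewrite !gray_wh // grayC.
  + move=> c c' /mapP[l _ ->] /mapP[l' _ ->]; rewrite xpair_eqE eqxx /=.
    exact: white_nbl.
- move=> u v C /not_white_nwh[a1 [a2 [a12 na]]] /not_white_nwh[b1 [b2 [b12 nb]]] uv CG CB.
  rewrite leqNgt; apply/negP => tC.
  pose cs : seq idx := [seq (c, ord0) | c <- enum C].
  have csP c : c \in cs -> exists2 i, i \in C & c = (i, ord0).
    by move=> /mapP[i]; rewrite mem_enum => iC ->; exists i.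
  have [uvn _ _] := and3P uv; have vu := uv; rewrite grayC in vu.
  have ncs i l : (i == u) || (i == v) -> (i, l) \notin cs.
    move=> iuv; apply/negP => /csP[j jC [ij _]]; have := CG _ jC; rewrite -ij.
    by rewrite /gray; case/orP: iuv => /eqP ->; rewrite eqxx ?andbF.
  have vun : v != u by rewrite eq_sym.
  apply: (@no_copy_seq (u, a1) (v, b1) [:: (u, a2), (v, b2) & cs]).
  + rewrite /= !inE !xpair_eqE !eqxx (negPf a12) (negPf b12) (negPf uvn) (negPf vun) /=.
    rewrite !ncs ?eqxx ?orbT //= map_inj_uniq ?enum_uniq //.
    by move=> i j [].
  + by rewrite /= size_map -cardE; move: tC; rewrite addn3 !ltnS.
  + exact: gray_bl.
  + move=> c; rewrite !inE => /or3P[/eqP ->|/eqP ->|/csP[i /CG/andP[ui vi] ->]].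
    * by rewrite na gray_wh.
    * by rewrite nb gray_wh.
    * by rewrite !gray_wh.
  + move=> c c'; rewrite !inE.
    case/or3P=> [/eqP ->|/eqP ->|/csP[i iC ->]]; case/or3P=> [/eqP ->|/eqP ->|/csP[j jC ->]];
      rewrite ?eqxx //.
    * by rewrite gray_bl.
    * by rewrite gray_bl //; case/andP: (CG _ jC).
    * by rewrite gray_bl.
    * by rewrite gray_bl //; case/andP: (CG _ jC).
    * by rewrite blC gray_bl //; case/andP: (CG _ iC).
    * by rewrite blC gray_bl //; case/andP: (CG _ iC).
    * by rewrite xpair_eqE andbT => ij; apply: CB.
- move=> u v C uv wuv CG CB; rewrite leqNgt; apply/negP => tC.
  pose cs : seq idx := [seq (c, ord0) | c <- enum C].
  have csP c : c \in cs -> exists2 i, i \in C & c = (i, ord0).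
    by move=> /mapP[i]; rewrite mem_enum => iC ->; exists i.
  have ncs i l : (i == u) || (i == v) -> (i, l) \notin cs.
    move=> iuv; apply/negP => /csP[j jC [ij _]]; have := CG _ jC; rewrite -ij.
    by rewrite /gray; case/orP: iuv => /eqP ->; rewrite eqxx ?andbF.
  apply: (@no_copy_seq (u, ord0) (v, ord0) cs).
  + rewrite /= inE xpair_eqE (negPf uv) /= !ncs ?eqxx ?orbT //= map_inj_uniq ?enum_uniq //.
    by move=> i j [].
  + by rewrite size_map -cardE; move: tC; rewrite addn1 ltnS.
  + exact: wh_nbl.
  + by move=> c /csP[i /CG/andP[ui vi] ->]; rewrite !gray_wh.
  + by move=> c c' /csP[i iC ->] /csP[j jC ->]; rewrite xpair_eqE andbT => ij; apply: CB.
Qed.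

End Array.

End K2tDensity.

(** * Cost of colour patterns on sampled points *)

Section Patterns.
Variables (R : realType) (t k : nat) (p eta : R).
Hypotheses (t_ge5 : (5 <= t)%N) (k_gt0 : (0 < k)%N).
Hypotheses (eta0 : 0 < eta) (eta_lt : 2 * eta < 1).
Hypothesis p_itv :
  (2 * t%:R - 1) / (t%:R * (t%:R + 1)) <= p <= 2 / (t%:R + 1).
Notation colors := (bool * bool)%type.
Notation pattern_type := {ffun 'I_k * 'I_k -> colors}.

Definition pattern (T : finType) (U : T -> T -> R) (x : {ffun 'I_k -> T}) : pattern_type :=
  [ffun e => (whiteb U eta (x e.1) (x e.2), blackb U eta (x e.1) (x e.2))].

Definition color_cost (c : colors) : R := if c.1 then p else if c.2 then 1 - p else 0.

(** The diagonal is left out because a pattern does not determine the colours of the vertices. Each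
    diagonal entry of the form is at most 1, whence the term [- k%:R] in [frequent_pattern_cost]. *)
Definition pattern_cost (pi : pattern_type) : R :=
  \sum_i \sum_(j | j != i) color_cost (pi (i, j)).

Lemma p01 : 0 <= p <= 1.
Proof.
have t5 : 5 <= t%:R :> R by rewrite ler_nat.
case/andP: p_itv => h1 h2; apply/andP; split.
  by apply: le_trans h1; apply: divr_ge0; [lra|apply: mulr_ge0; lra].
by apply: (le_trans h2); rewrite ler_pdivrMr; lra.
Qed.

(** A frequent pattern has many blow-ups, while copies are rare; some array is thus a blow-up
    without copies. Its coloured graph is [K2t_free], and [crg_bound] at the uniform weighting 1/k
    bounds the cost of the pattern. *)
Lemma frequent_pattern_cost (tau : R) : 0 < tau -> exists2 e1, 0 < e1 &
  forall (T : finType) (U : T -> T -> R) (pi : pattern_type), (0 < #|T|)%N ->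
    (forall x y, 0 <= U x y <= 1) -> (forall x y, U x y = U y x) ->
    K2t_density t U <= e1 -> tau <= avg (fun x => (pattern U x == pi)%:R) ->
    1 / (t%:R + 1) * k%:R ^+ 2 - k%:R <= pattern_cost pi.
Proof.
move=> tau0; pose m := t.-1; have tm : t = m.+1 by rewrite prednK // (leq_trans _ t_ge5).
have [d d0 Hd] := @blowup_dense R k m tau tau0.
pose idx := ('I_k * 'I_m.+1)%type.
pose embeddings := {ffun 'I_(2 + t) -> idx}.
pose N : R := #|{: embeddings}|%:R.
have N0 : 0 <= N by exact: ler0n.
pose E := eta ^+ size (K2t_pairs t).
have E0 : 0 < E by exact: exprn_gt0.
(* A copy has weight at least E, so this bound on the density makes the expected number of copies,
   over at most N embeddings, at most N d / (N + 1) < d. *)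
have e10 : 0 < d * E / (N + 1) by rewrite divr_gt0 ?mulr_gt0 // ltr_wpDl.
exists (d * E / (N + 1)) => // T U pi T0 U01 Usym dens freq.
have {freq}blow := Hd T (fun x => pattern U x == pi) T0 freq.
have copies : avg (fun x : {ffun 'I_(2 + t) -> T} => (template_copy U eta x)%:R) <= d / (N + 1).
  have := le_trans (template_copy_density t U01 eta0) dens.
  by rewrite -ler_pdivlMr // mulrAC mulfK ?lt0r_neq0.
pose bad (X : {ffun idx -> T}) : R :=
  \sum_(psi : embeddings | injectiveb psi) (template_copy U eta (pull psi X))%:R.
(* An array with fewer copies than the value of its blow-up indicator is a blow-up and has no copy
   at all. *)
have [X] : exists X, bad X < (full_blowup (fun x => pattern U x == pi) X)%:R.
  apply: avg_lt_witness; apply: lt_le_trans blow; rewrite avg_sum.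
  apply: (@le_lt_trans _ _ (\sum_(psi : embeddings) d / (N + 1))).
    rewrite big_mkcond ler_sum // => psi _; case: ifP => [/injectiveP psi_inj|_].
      by rewrite (avg_pull T0 (fun x : {ffun 'I_(2 + t) -> T} => (template_copy U eta x)%:R)).
    by rewrite divr_ge0 ?(ltW d0) // addr_ge0.
  rewrite sumr_const -[_ *+ _]mulr_natl -/N mulrA ltr_pdivrMr ?ltr_wpDl //.
  by rewrite mulrC ltr_pM2l //; lra.
have bad0 : 0 <= bad X by apply: sumr_ge0 => psi _; exact: ler0n.
case: (boolP (full_blowup _ X)) => [blowX|_]; last by move=> /(le_lt_trans bad0); rewrite ltxx.
move=> bad1.
have no_copy (psi : embeddings) : injective psi -> ~~ template_copy U eta (pull psi X).
  move=> psi_inj; apply/negP => cp; move: bad1; rewrite ltNge /bad.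
  rewrite (bigD1 psi) /=; last exact/injectiveP.
  by rewrite cp lerDl sumr_ge0 // => *; exact: ler0n.
have piX i j a b : i != j ->
    pi (i, j) = (whiteb U eta (X (i, a)) (X (j, b)), blackb U eta (X (i, a)) (X (j, b))).
  move=> ij; have /eqP <- := forallP blowX [ffun l => if l == i then a else b].
  by rewrite !ffunE /= eqxx eq_sym (negPf ij).
have free : K2t_free t (array_white U eta X) (array_black U eta X) (array_white_vertex U eta X).
  apply: (array_K2t_free Usym no_copy eta_lt tm); first exact: leq_trans t_ge5.
    by move=> i j a b a' b' ij; have := piX _ _ a b ij; rewrite (piX _ _ a' b' ij) => -[].
  by move=> i j a b a' b' ij; have := piX _ _ a b ij; rewrite (piX _ _ a' b' ij) => -[].
have k0 : 0 < k%:R :> R by rewrite ltr0n.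
have wk : weighting (fun _ : 'I_k => 1 / k%:R : R).
  split=> [_|]; first by rewrite divr_ge0.
  by rewrite sumr_const card_ord -[_ *+ _]mulr_natr divfK // lt0r_neq0.
have := crg_bound t_ge5 free p_itv wk.
set M := crg_mx _ _ _ _.
have -> : quad M (fun=> 1 / k%:R) = (\sum_i \sum_j M i j) / k%:R ^+ 2.
  rewrite /quad mulr_suml; apply: eq_bigr => i _; rewrite mulr_suml.
  by apply: eq_bigr => j _; rewrite !mul1r expr2 invfM mulrA.
rewrite ler_pdivlMr ?exprn_gt0 // lerBlDr => /le_trans; apply.
have -> : k%:R = \sum_(i < k) 1 :> R by rewrite sumr_const card_ord.
rewrite /pattern_cost -big_split /= ler_sum // => i _.
rewrite (bigD1 i) //= addrC lerD //.
  rewrite le_eqVlt; apply/orP; left; apply/eqP; apply: eq_bigr => j ji.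
  rewrite eq_sym in ji.
  by rewrite (piX i j ord0 ord0) // /M /crg_mx (negPf ji).
by have /andP[p0 p1] := p01; rewrite /M /crg_mx eqxx; case: ifP => _; lra.
Qed.

Lemma pattern_cost_ge0 pi : 0 <= pattern_cost pi.
Proof.
apply: sumr_ge0 => i _; apply: sumr_ge0 => j _; rewrite /color_cost.
by have /andP[p0 p1] := p01; case: ifP => _; [|case: ifP => _]; lra.
Qed.

Lemma pattern_cost_le (T : finType) (U : T -> T -> R) (x : {ffun 'I_k -> T}) :
  pattern_cost (pattern U x) - eta * k%:R ^+ 2 <=
    \sum_i \sum_(j | j != i) `|p - U (x i) (x j)|.
Proof.
have -> : eta * k%:R ^+ 2 = \sum_(i < k) \sum_(j < k) eta.
  by rewrite !sumr_const card_ord -!mulrnA -[eta *+ _]mulr_natr natrM expr2.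
rewrite /pattern_cost -sumrB ler_sum // => i _.
apply: (@le_trans _ _ (\sum_(j | j != i) (color_cost (pattern U x (i, j)) - eta))).
  rewrite sumrB lerB // [leRHS](bigID (fun j => j != i)) /= lerDl.
  by apply: sumr_ge0 => j _; exact: ltW.
apply: ler_sum => j _; rewrite ffunE /color_cost /= /whiteb /blackb.
have := ler_norm (p - U (x i) (x j)); have := ler_norm (- (p - U (x i) (x j))).
rewrite normrN; have := eta0.
by case: ifP => [|_]; [|case: ifP => [|_]]; have := normr_ge0 (p - U (x i) (x j)); lra.
Qed.

End Patterns.

(** Averages the cost over k random points. Each of three errors takes eps/3: rounding [U] to
    colours ([eta]), the missing diagonal (1/k), and the patterns of frequency below [tau], of which
    there are at most N. *)
Lemma sampling (R : realType) (t : nat) (p eps : R) : (5 <= t)%N ->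
  (2 * t%:R - 1) / (t%:R * (t%:R + 1)) <= p <= 2 / (t%:R + 1) -> 0 < eps ->
  exists2 e1, 0 < e1 & forall (T : finType) (U : T -> T -> R), (0 < #|T|)%N ->
    (forall x y, 0 <= U x y <= 1) -> (forall x y, U x y = U y x) ->
    K2t_density t U <= e1 ->
    1 / (t%:R + 1) - eps <= avg (fun x => avg (fun y => `|p - U x y|)).
Proof.
move=> t_ge5 p_itv eps0.
pose eta := Num.min (eps / 3) (1 / 3).
have eta0 : 0 < eta by rewrite lt_min !divr_gt0.
have eta_eps : eta <= eps / 3 by rewrite ge_min lexx.
have eta_lt : 2 * eta < 1.
  have : eta <= 1 / 3 by rewrite ge_min lexx orbT.
  lra.
have [k k_gt0 k_eps] : exists2 k : nat, (0 < k)%N & 1 <= eps / 3 * k%:R.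
  exists (Num.bound (3 / eps)).+1 => //; rewrite -ler_pdivrMl ?divr_gt0 // mulr1 invf_div.
  apply: ltW; apply: lt_trans (archi_boundP _) _; first by rewrite divr_ge0 // ltW.
  by rewrite ltr_nat.
pose N : R := #|{: {ffun 'I_k * 'I_k -> bool * bool}}|%:R.
have N0 : 0 < N by rewrite ltr0n; apply/card_gt0P; exists [ffun=> (true, true)].
pose tau := eps / 3 / N.
have tau0 : 0 < tau by rewrite !divr_gt0.
have [e1 e10 He1] := frequent_pattern_cost t_ge5 k_gt0 eta0 eta_lt p_itv tau0.
exists e1 => // T U T0 U01 Usym dens; set D := avg _.
pose freq pi := tau <= avg (fun x : {ffun 'I_k -> T} => (pattern eta U x == pi)%:R).
pose c0 : R := 1 / (t%:R + 1).
have k0 : 0 < k%:R :> R by rewrite ltr0n.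
have c01 : c0 <= 1 by rewrite ler_pdivrMr ?mul1r ?lerDr ?ler0n // ltr_wpDl.
have D0 : 0 <= D by apply: avg_ge0 => x; apply: avg_ge0.
have pointwise (x : {ffun 'I_k -> T}) :
    c0 * k%:R ^+ 2 - k%:R - eta * k%:R ^+ 2
      - k%:R ^+ 2 * (\sum_(pi | ~~ freq pi) (pattern eta U x == pi)%:R) <=
    \sum_i \sum_(j | j != i) `|p - U (x i) (x j)|.
  apply: le_trans (pattern_cost_le p eta0 U x).
  set pi := pattern eta U x; have [fpi|nfpi] := boolP (freq pi).
    have := He1 T U pi T0 U01 Usym dens fpi; rewrite -/c0.
    have : 0 <= k%:R ^+ 2 * (\sum_(pi' | ~~ freq pi') (pi == pi')%:R) :> R.
      by rewrite mulr_ge0 ?exprn_ge0 ?ler0n // sumr_ge0.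
    lra.
  rewrite (bigD1 pi) //= eqxx big1 ?addr0 ?mulr1 => [|pi' /andP[_]]; last first.
    by rewrite eq_sym => /negPf ->.
  have := pattern_cost_ge0 t_ge5 p_itv pi.
  have : c0 * k%:R ^+ 2 <= k%:R ^+ 2 by rewrite ler_piMl // exprn_ge0 // ler0n.
  lra.
have avgD : avg (fun x : {ffun 'I_k -> T} => \sum_i \sum_(j | j != i) `|p - U (x i) (x j)|)
    <= k%:R ^+ 2 * D.
  rewrite avg_sum.
  apply: (@le_trans _ _ (\sum_(i < k) \sum_(j < k) D)).
    apply: ler_sum => i _; rewrite avg_sum big_mkcond; apply: ler_sum => j _.
    case: ifP => // ji; rewrite (@avg_ffun2 _ _ T0 _ i j (fun z w => `|p - U z w|)) //.
    by rewrite eq_sym.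
  by rewrite !sumr_const card_ord -!mulrnA -[D *+ _]mulr_natl natrM expr2.
have := le_trans (le_avg pointwise) avgD.
rewrite avgB avgZ avg_sum avg_cst; last exact: card_ffun_gt0.
have rare : \sum_(pi | ~~ freq pi)
    avg (fun x : {ffun 'I_k -> T} => (pattern eta U x == pi)%:R) <= eps / 3.
  apply: (@le_trans _ _ (\sum_(pi : {ffun 'I_k * 'I_k -> bool * bool}) tau)).
    rewrite big_mkcond ler_sum // => pi _; case: ifP => [|_]; last exact: ltW.
    by rewrite -ltNge => /ltW.
  by rewrite sumr_const -[_ *+ _]mulr_natl -/N mulrC divfK // lt0r_neq0.
move=> main; rewrite -/c0.
have K2 : 0 < k%:R ^+ 2 :> R by rewrite exprn_gt0.
rewrite -(ler_pM2l K2).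
have kk : k%:R <= eps / 3 * k%:R ^+ 2.
  by rewrite expr2 mulrA -[leLHS]mul1r ler_pM2r.
have := ler_wpM2l (ltW K2) rare; have := ler_wpM2l (ltW K2) eta_eps.
lra.
Qed.

(** * From edited graphs to averaged kernels *)

Section StepDistance.
Variable R : realFieldType.

Lemma sum_abs_cexp (Z L : finType) (l : Z -> L) (F : Z -> R) :
  \sum_z `|cexp l F z| = \sum_a `|\sum_(z | l z == a) F z|.
Proof.
rewrite (partition_big l predT) //=; apply: eq_bigr => a _.
have [z0 /eqP z0a|noz] := pickP (fun z => l z == a); last first.
  by rewrite !big_pred0 // normr0.
rewrite (eq_bigr (fun=> `|cexp l F z0|)) => [|z /eqP za]; last first.
  by rewrite (@cexp_eq _ _ _ l F z z0) // za.
rewrite sumr_const /cexp z0a normrM normfV normr_nat -[_ *+ _]mulr_natr divfK //.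
by rewrite pnatr_eq0 -lt0n; apply/card_gt0P; exists z0; rewrite inE z0a.
Qed.

Lemma cexp_cstB (Z L : finType) (l : Z -> L) (c : R) (F : Z -> R) z :
  cexp l (fun z => c - F z) z = c - cexp l F z.
Proof.
rewrite /cexp sumrB mulrBl sumr_const -[_ *+ _]mulr_natr mulfK //.
by rewrite pnatr_eq0 -lt0n; apply/card_gt0P; exists z; exact: eqxx.
Qed.

(* On a block of the partition the averaged kernel is constant, so only the
   sums over blocks matter; there [G] has density [p]. *)
Lemma step_dist (T L : finType) (l : T -> L) (G G' : sgraph T) (p c : R) :
  cut_le c (fun x y => (adj G x y)%:R - p) ->
  \sum_x \sum_y `|p - step l (fun x y => (adj G' x y)%:R) x y| <=
    (2 * edit_dist G G')%:R + (#|L| ^ 2)%:R * (c * #|T|%:R ^+ 2).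
Proof.
move=> Gc; pose l2 (z : T * T) := (l z.1, l z.2).
pose D (z : T * T) : R := (adj G z.1 z.2)%:R - (adj G' z.1 z.2)%:R.
pose K (z : T * T) : R := (adj G z.1 z.2)%:R - p.
rewrite pair_bigA /= (eq_bigr (fun z => `|cexp l2 (fun z => p - (adj G' z.1 z.2)%:R) z|)); last first.
  by move=> [x y] _; rewrite cexp_cstB.
rewrite sum_abs_cexp.
apply: (@le_trans _ _ (\sum_a (`|\sum_(z | l2 z == a) D z| + `|\sum_(z | l2 z == a) K z|))).
  apply: ler_sum => a _; rewrite -(normrN (\sum_(z | _) K z)).
  apply: le_trans (ler_normD _ _); rewrite -sumrN -big_split /=.
  rewrite le_eqVlt; apply/orP; left; apply/eqP; congr (`|_|).
  by apply: eq_bigr => z _; rewrite /D /K; ring.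
rewrite big_split /= lerD //.
  apply: (@le_trans _ _ (\sum_a \sum_(z | l2 z == a) `|D z|)).
    by apply: ler_sum => a _; exact: ler_norm_sum.
  have <- : \sum_z `|D z| = \sum_a \sum_(z | l2 z == a) `|D z|.
    by rewrite (partition_big l2 predT).
  by rewrite -(pair_bigA _ (fun x y => `|D (x, y)|)) /= edit_dist_sumR.
have -> : (#|L| ^ 2)%:R * (c * #|T|%:R ^+ 2) = \sum_(a : L * L) c * #|T|%:R ^+ 2.
  by rewrite sumr_const card_prod mulnn mulr_natl.
apply: ler_sum => -[a b] _; apply: le_trans (Gc [set x | l x == a]%SET [set y | l y == b]%SET).
rewrite le_eqVlt; apply/orP; left; apply/eqP; congr (`|_|).
rewrite cutE big_mkcond; apply: eq_bigr => z _; rewrite !inE /l2 xpair_eqE /K.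
by case: (_ && _); rewrite ?mulr1 ?mulr0.
Qed.

End StepDistance.

Section ForbDensity.
Variables (R : realFieldType) (t : nat) (T : finType) (G : sgraph T).
Hypothesis T_gt0 : (0 < #|T|)%N.

Let W x y : R := (adj G x y)%:R.

(** An injective map has weight 0, since otherwise it would be an induced copy. The others have
    weight at most 1, and a union bound over the pairs counts them: each pair coincides with
    probability 1/|T|. *)
Lemma Forb_K2t_density : Forb (complete_bipartite 2 t) G ->
  K2t_density t W <= (size (K2t_pairs t))%:R / #|T|%:R.
Proof.
move=> GF.
have W01 x y : 0 <= W x y <= 1 by rewrite /W ler0n lern1 leq_b1.
apply: (@le_trans _ _ (avg (fun x : {ffun 'I_(2 + t) -> T} =>
    \sum_(e <- K2t_pairs t) (x e.1 == x e.2)%:R))).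
  apply: le_avg => x.
  have [x_inj|] := boolP (injectiveb x); last first.
    move=> /injectivePn[i [j ij xij]].
    wlog ltij : i j ij xij / (i < j)%N.
      move=> H; case: (ltngtP i j) => [lt|lt|eq].
      - exact: (H i j).
      - by apply: (H j i); rewrite // eq_sym.
      - by move/val_inj: eq ij => ->; rewrite eqxx.
    have ijE : (i, j) \in K2t_pairs t by rewrite mem_K2t_pairs.
    rewrite [leRHS](big_rem (i, j)) //= xij eqxx.
    have /andP[_ le1] := prod_itv (K2t_pairs t) predT
      (fun e => K2t_weight_itv e (x e.1) (x e.2) W01).
    by apply: (le_trans le1); rewrite lerDl sumr_ge0 // => *; exact: ler0n.
  move/injectiveP: x_inj => x_inj.
  have [bad|good] := boolP (has (fun e => K2t_weight W e (x e.1) (x e.2) == 0) (K2t_pairs t)).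
    have /hasP[e eE /eqP e0] := bad.
    rewrite (big_rem e) //= e0 mul0r sumr_ge0 // => *; exact: ler0n.
  exfalso.
  have pairsP (i j : 'I_(2 + t)) : (i < j)%N -> adj G (x i) (x j) = K2t_edge (i, j).
    move=> ij; have := hasPn good (i, j); rewrite mem_K2t_pairs => /(_ ij).
    rewrite /K2t_weight /W /=; case: ifP => _; case: (adj G _ _) => //=.
      by rewrite eqxx.
    by rewrite subrr eqxx.
  suff /ForbPn[S HS] : exists2 f : ('I_2 + 'I_t)%type -> T, injective f &
    forall u v, adj G (f u) (f v) = adj (complete_bipartite 2 t) u v by exact: (GF S).
  exists (fun u => x (unsplit u)); first exact: inj_comp x_inj (can_inj unsplitK).
  have adj_lt u v : (unsplit u < unsplit v)%N ->
      adj G (x (unsplit u)) (x (unsplit v)) = adj (complete_bipartite 2 t) u v.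
    move=> uv; rewrite pairsP // /K2t_edge.
    case: u v uv => [i|j] [i'|j'] /= uv.
    - rewrite [(2 <= _)%N]leqNgt (ltn_ord i') andbF; apply/esym/negP => /imset2P[a b _ _].
      by move=> /finset.setP/(_ (inr b)); rewrite !inE eqxx orbT.
    - rewrite ltn_ord leq_addr; apply/esym.
      by apply/imset2P; exists i j'.
    - by move: uv; rewrite ltnNge ltnW // (leq_trans (ltn_ord _)) // leq_addr.
    - apply/esym/negP => /imset2P[a b _ _].
      by move=> /finset.setP/(_ (inl a)); rewrite !inE eqxx.
  have adj0 (U : finType) (H : sgraph U) a : adj H a a = false.
    by apply/negP => /adj_neq; rewrite eqxx.
  move=> u v; case: (ltngtP (unsplit u) (unsplit v)) => [|uv|/val_inj uv].
  - exact: adj_lt.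
  - by rewrite adjC [RHS]adjC adj_lt.
  - by have := can_inj unsplitK uv => ->; rewrite !adj0.
rewrite avg_sum -[(size _)%:R]mulr_natr mul1r -sum1_size natr_sum mulr_suml.
rewrite big_seq [leRHS]big_seq; apply: ler_sum => e; rewrite mem_K2t_pairs => lt_e.
rewrite (@avg_ffun2 _ _ T_gt0 _ _ _ (fun z w => (z == w)%:R)); last first.
  by apply: contraTneq lt_e => ->; rewrite ltnn.
rewrite (@eq_avg _ _ _ (fun=> 1 / #|T|%:R)); first by rewrite avg_cst.
move=> z; by rewrite -(avg_pred1 _ z); apply: eq_avg => w; rewrite eq_sym.
Qed.

End ForbDensity.

Lemma max_dist_lower (R : realType) (t : nat) (p eps : R) : (5 <= t)%N ->
  (2 * t%:R - 1) / (t%:R * (t%:R + 1)) <= p <= 2 / (t%:R + 1) -> 0 < eps ->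
  exists n0 : nat, forall n, (n0 <= n)%N ->
    (1 / (t%:R + 1) - eps) * 'C(n, 2)%:R <=
      (max_dist (Forb (complete_bipartite 2 t)) p n)%:R.
Proof.
move=> t_ge5 p_itv eps0.
have e20 : 0 < eps / 2 by rewrite divr_gt0.
have [e1 e10 He1] := sampling t_ge5 p_itv e20.
pose E : R := (size (K2t_pairs t))%:R.
have E0 : 0 <= E by exact: ler0n.
(* Half of [e1] pays for the counting error over E pairs; the other half is for the density of G'
   itself, which is of order 1/n. *)
have c0 : 0 < e1 / (2 * (E + 1)) by rewrite divr_gt0 // mulr_gt0 // ltr_wpDl.
have [M HM] := weak_regularity c0.
(* [step_dist] charges this cut error once for each of at most M^2 pairs of blocks, in total at most
   eps/2. *)
have g0 : 0 < eps / 2 / (M%:R ^+ 2 + 1).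
  by rewrite divr_gt0 // ltr_wpDl // exprn_ge0 // ler0n.
have [n1 Hn1] := quasirandom_graph (p01 t_ge5 p_itv) g0.
have [n2 n2P] : exists n2 : nat, 2 * E / e1 < n2%:R.
  exists (Num.bound (2 * E / e1)); apply: archi_boundP.
  by rewrite divr_ge0 ?mulr_ge0 // ltW.
exists (maxn (maxn n1 n2) 1) => n; rewrite !geq_max -andbA => /and3P[n1n n2n n0].
have [G [Gcard Gcut]] := Hn1 n n1n.
have N0 : 0 < n%:R :> R by rewrite ltr0n.
apply: (@le_trans _ _ (dist_to (Forb (complete_bipartite 2 t)) G)%:R); last first.
  by rewrite ler_nat; exact: (leq_bigmax_cond (F := fun G => dist_to _ G) G Gcard).
have C0 : 0 <= 'C(n, 2)%:R :> R by exact: ler0n.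
have c01 : 1 / (t%:R + 1) <= 1 :> R.
  by rewrite ler_pdivrMr ?mul1r ?lerDr ?ler0n // ltr_wpDl.
apply: dist_to_ge => [|G' GF]; first by rewrite card_ord ler_piMl //; lra.
have T0 : (0 < #|'I_n|)%N by rewrite card_ord.
pose W x y : R := (adj G' x y)%:R.
have W01 x y : 0 <= W x y <= 1 by rewrite /W ler0n lern1 leq_b1.
have Wsym x y : W x y = W y x by rewrite /W adjC.
have [L [l [LM Lcut]]] := HM _ W T0 W01.
pose U := step l W.
have U01 x y : 0 <= U x y <= 1 by exact: step_itv.
have Usym x y : U x y = U y x by exact: step_sym.
have Udens : K2t_density t U <= e1.
  have close : `|K2t_density t W - K2t_density t U| <= e1 / (2 * (E + 1)) * E.
    apply: density_close => //.
    - move=> e; case: (boolP (K2t_edge e)) => ee.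
        by apply: cut_le_ext Lcut => x y; rewrite /K2t_weight ee.
      have Lcut' : cut_le (e1 / (2 * (E + 1))) (fun x y => - (W x y - U x y)).
        move=> A B; have := Lcut A B; congr (_ <= _); rewrite -normrN; congr (`|_|).
        by rewrite /cut -sumrN; apply: eq_bigr => x _; rewrite -sumrN.
      by apply: cut_le_ext Lcut' => x y; rewrite /K2t_weight (negPf ee); ring.
    - by move=> e x y; exact: K2t_weight_itv.
    - by move=> e x y; exact: K2t_weight_itv.
    - exact: K2t_pairs_uniq.
    - by apply/allP => e; rewrite mem_K2t_pairs.
  have e1E : e1 / (2 * (E + 1)) * E <= e1 / 2.
    have E1 : 0 < E + 1 by rewrite ltr_wpDl.
    have -> : e1 / (2 * (E + 1)) * E = (e1 / 2) * (E / (E + 1)).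
      by field; exact: lt0r_neq0.
    by rewrite ler_piMr ?divr_ge0 ?(ltW e10) // ler_pdivrMr // mul1r lerDl.
  have Wdens : K2t_density t W <= e1 / 2.
    apply: le_trans (Forb_K2t_density _ T0 GF) _; rewrite card_ord -/E.
    rewrite ler_pdivrMr // -ler_pdivrMl ?divr_gt0 // invf_div mulrAC.
    by apply: ltW; apply: lt_le_trans n2P _; rewrite ler_nat.
  by move: close; rewrite ler_norml => /andP[close _]; lra.
have := He1 _ U T0 U01 Usym Udens.
have -> : avg (fun x => avg (fun y => `|p - U x y|)) =
    (\sum_x \sum_y `|p - U x y|) / n%:R ^+ 2.
  by rewrite /avg -mulr_suml expr2 invfM mulrA card_ord.
rewrite ler_pdivlMr ?exprn_gt0 // => /le_trans/(_ (step_dist l G' Gcut)).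
rewrite card_ord natrM; set d := (edit_dist _ _)%:R => main.
have LM2 : (#|L| ^ 2)%:R * (eps / 2 / (M%:R ^+ 2 + 1) * n%:R ^+ 2) <= eps / 2 * n%:R ^+ 2.
  have M1 : 0 < M%:R ^+ 2 + 1 :> R by rewrite ltr_wpDl // exprn_ge0 // ler0n.
  rewrite mulrA ler_pM2r ?exprn_gt0 // mulrA ler_pdivrMr // mulrC ler_pM2l //.
  rewrite natrX; apply: (@le_trans _ _ (M%:R ^+ 2)); last by rewrite lerDl.
  by rewrite ler_pXn2r ?nnegrE ?ler0n // ler_nat.
have C2 : 2 * 'C(n, 2)%:R = n%:R ^+ 2 - n%:R :> R := bin2R R n.
move: main LM2 C2 C0; set c := 1 / _ => main LM2 C2 C0.
have d0 : 0 <= d by exact: ler0n.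
have [ceps|ceps] := lerP (c - eps) 0; first by apply: le_trans d0; apply: mulr_le0_ge0.
have : (c - eps) * n%:R ^+ 2 <= 2 * d by lra.
have : 0 <= (c - eps) * n%:R by rewrite mulr_ge0 // ltW.
have : 2 * ((c - eps) * 'C(n, 2)%:R) = (c - eps) * n%:R ^+ 2 - (c - eps) * n%:R.
  by rewrite mulrCA C2; ring.
lra.
Qed.

Lemma max_dist_upper (R : realType) (t : nat) (p : R) n : odd t ->
  (max_dist (Forb (complete_bipartite 2 t)) p n)%:R / 'C(n, 2)%:R <= 1 / (t%:R + 1) :> R.
Proof.
move=> t_odd.
have ts : t.+1 = (2 * t.+1./2)%N by rewrite mul2n -[LHS]odd_double_half /= t_odd.
have : (max_dist (Forb (complete_bipartite 2 t)) p n * t.+1 <= 'C(n, 2))%N.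
  rewrite -leq_divRL //; apply/bigmax_leqP => G _; rewrite leq_divRL //.
  by have := dist_to_Forb_le G ts; rewrite card_ord.
have t1 : 0 < t%:R + 1 :> R by rewrite ltr_wpDl.
have [->|C0] := posnP 'C(n, 2); first by rewrite invr0 mulr0 divr_ge0 // ltW.
by rewrite -(ler_nat R) natrM -natr1 ler_pdivrMr ?ltr0n // mulrAC ler_pdivlMr // mul1r.
Qed.

Lemma ed_Forb_K2t (R : realType) (t : nat) (p : R) : (5 <= t)%N -> odd t ->
  (2 * t%:R - 1) / (t%:R * (t%:R + 1)) <= p <= 2 / (t%:R + 1) ->
  ed (Forb (complete_bipartite 2 t)) p = 1 / (t%:R + 1).
Proof.
move=> t_ge5 t_odd p_itv; apply: cvg_lim => //.
apply/cvgrPdist_le => e e0; have [n0 Hn0] := max_dist_lower t_ge5 p_itv e0.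
exists (maxn n0 2) => // n /=; rewrite geq_max => /andP[n0n n2].
have C0 : 0 < 'C(n, 2)%:R :> R by rewrite ltr0n bin_gt0.
have up := max_dist_upper p n t_odd.
have := Hn0 n n0n; rewrite -ler_pdivlMr // => low.
by rewrite ger0_norm; lra.
Qed.

(** No convergence is assumed here: a convergent sequence inherits the bound of its terms, and a
    divergent one has the default limit 0, which satisfies the bound too. *)
Lemma ed_Forb_K2t_le (R : realType) (t : nat) (p : R) : odd t ->
  ed (Forb (complete_bipartite 2 t)) p <= 1 / (t%:R + 1).
Proof.
move=> t_odd; rewrite /ed; set u := (fun n : nat => _ : R).
have [cu|du] := pselect (cvgn u).
  by apply: limr_le => //; apply: nearW => n; exact: max_dist_upper.
have -> : limn u = 0 by exact: dvgP.
by rewrite divr_ge0 // addr_ge0.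
Qed.

Local Open Scope classical_set_scope.
Local Open Scope ring_scope.

Theorem theorem7 (R : realType) (t : nat) (t_ge5 : (5 <= t)%N) (t_odd : odd t) :
  is_ed_max (Forb (complete_bipartite 2 t)) (1 / (t%:R + 1) : R) /\
  ([set` `[(2 * t%:R - 1) / (t%:R * (t%:R + 1)), 2 / (t%:R + 1)]] : set R)
    `<=` ed_argmax (Forb (complete_bipartite 2 t)).
Proof.
have t5 : 5 <= t%:R :> R by rewrite ler_nat.
have is_max : is_ed_max (Forb (complete_bipartite 2 t)) (1 / (t%:R + 1) : R).
  split=> [|p _]; last exact: ed_Forb_K2t_le.
  pose p : R := 2 / (t%:R + 1).
  have p_itv : (2 * t%:R - 1) / (t%:R * (t%:R + 1)) <= p <= 2 / (t%:R + 1).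
    rewrite lexx andbT /p ler_pdivrMr ?mulr_gt0 //; try lra.
    have -> : 2 / (t%:R + 1) * (t%:R * (t%:R + 1)) = 2 * t%:R :> R.
      by field; apply: lt0r_neq0; lra.
    lra.
  exists p; last exact: ed_Forb_K2t.
  by rewrite in_itv /=; exact: p01 p_itv.
split=> // p /=; rewrite in_itv /= => p_itv.
by split; [rewrite in_itv /=; exact: p01 p_itv|rewrite ed_Forb_K2t].
Qed.
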